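(* Let $\ell\ge2$, $\ell_1=\lfloor\ell/2\rfloor$, $\ell_2=\lceil\ell/2\rceil$, and $A=\begin{pmatrix}0&0\\ \epsilon&0\end{pmatrix}\in\mathfrak g(\mathfrak o_{\ell_1})$. For any irreducible representations $\rho_1,\rho_2$ of $\mathrm G(\mathfrak o_\ell)$ whose restrictions to $K^{\ell_2}$ contain $\psi_A$, there exists an irreducible representation $\rho$ of $\mathrm G(\mathfrak o_\ell)$ whose restriction to $K^{\ell_2}$ contains $\psi_A$ such that $\langle\rho_1\otimes\rho_2,\rho\rangle\geq(q-2)q^{\lfloor\ell_1/2\rfloor+\ell_1-\ell_2-1}$.
   Context: Let $\mathcal O$ be a complete discrete valuation ring with maximal ideal $\mathfrak p=\pi\mathcal O$ and finite residue field of odd characteristic and cardinality $q$. Let $\mathfrak O=\mathcal O[\vartheta]$ be the unramified quadratic extension, with $\vartheta^2\in\mathcal O^\times$ a non-square, and Galois involution $x\mapsto x^\circ$, $\vartheta^\circ=-\vartheta$. Let $\mathfrak o_k=\mathcal O/\mathfrak p^k$ and $\mathfrak O_k=\mathfrak O/\pi^k\mathfrak O$. $\mathrm G$ denotes either $\mathrm{GL}_2$ (so $\mathrm G(\mathfrak o_k)=\mathrm{GL}_2(\mathfrak o_k)$, $R_k=\mathfrak o_k$, $\epsilon=1$, $\mathfrak g(\mathfrak o_k)=M_2(\mathfrak o_k)$) or $\mathrm{GU}_2$ (so $\mathrm G(\mathfrak o_k)=\{A\in \mathrm{GL}_2(\mathfrak O_k): A^\star A=I\}$ where $(a_{ij})^\star=W(a_{ji}^\circ)W^{-1}$,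 $W=\begin{pmatrix}0&1\\1&0\end{pmatrix}$, $R_k=\mathfrak O_k$, $\epsilon=\vartheta$, $\mathfrak g(\mathfrak o_k)=\{A\in M_2(\mathfrak O_k):A+A^\star=0\}$). $K^{i}=\{I+\pi^iB\}\cap\mathrm G(\mathfrak o_\ell)$. Fix an additive character $\psi$ of $R_\ell$ nontrivial on $\pi^{\ell-1}\mathfrak o_\ell$ (for $\mathrm{GU}_2$ with $\psi(x+\vartheta y)=\psi'(x)\psi'(y)$ for such a character $\psi'$ of $\mathfrak o_\ell$). For $A\in\mathfrak g(\mathfrak o_{\ell_1})$, $\psi_A$ is the character $I+\pi^{\ell_2}B\mapsto\psi(\pi^{\ell_2}\mathrm{tr}(\tilde AB))$ of $K^{\ell_2}$, $\tilde A$ any lift of $A$ to $\mathfrak g(\mathfrak o_\ell)$. *)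

(* Defs.v *)
From HB Require Import structures.
From mathcomp Require Import all_boot all_order all_algebra all_fingroup all_field all_character.
From mathcomp Require Import ring.
Set Implicit Arguments. Unset Strict Implicit. Unset Printing Implicit Defensive.
Import Order.TTheory GRing.Theory Num.Theory.
Local Open Scope ring_scope.

Definition rdvd (O : comPzRingType) (a x : O) : Prop := exists y, x = a * y.

(* O is a complete discrete valuation ring with uniformizer pi:
   O is an integral domain, pi is a nonzero non-unit, every nonzero element is
   a unit times a power of pi (so O is a DVR with maximal ideal pi O), and O is
   complete for the pi-adic topology (every pi-adic Cauchy sequence converges). *)
Definition complete_dvr (O : idomainType) (pi : O) : Prop :=
  [/\ pi != 0, pi \isn't a GRing.unit,
      (forall x : O, x != 0 ->
         exists (k : nat) (u : O), u \is a GRing.unit /\ x = u * pi ^+ k) &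
      (forall a : nat -> O, (forall n, rdvd (pi ^+ n) (a n.+1 - a n)) ->
         exists L : O, forall n, rdvd (pi ^+ n) (L - a n))].

(* The residue field O / pi O is finite of cardinality q: there is a complete
   system of q pairwise incongruent representatives modulo pi. *)
Definition residue_card (O : idomainType) (pi : O) (q : nat) : Prop :=
  exists r : 'I_q -> O,
    (forall i j, rdvd pi (r i - r j) -> i = j) /\
    (forall x : O, exists i, rdvd pi (x - r i)).

(* f : O -> R identifies R with o_l = O / p^l : f is a surjective ring
   morphism whose kernel is pi^l O. *)
Definition is_quotient_pow (O : idomainType) (pi : O) (l : nat)
  (R : comPzRingType) (f : {rmorphism O -> R}) : Prop :=
  (forall y : R, exists x : O, f x = y) /\
  (forall x : O, f x = 0 <-> rdvd (pi ^+ l) x).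

(* The quadratic extension R[theta], theta^2 = d  (models O_l = O[theta]/pi^l) *)

Section Quad.
Variable R : finComUnitRingType.
Variable d : R.
Definition quad_of (d' : R) : Type := (R * R)%type.
Local Notation quad := (quad_of d).
HB.instance Definition _ := GRing.Zmodule.on quad.
HB.instance Definition _ := Finite.on quad.
(* (a + b theta)(c + e theta) = (ac + d be) + (ae + bc) theta *)
Definition qmul (x y : quad) : quad :=
  (x.1 * y.1 + d * (x.2 * y.2), x.1 * y.2 + x.2 * y.1).
Definition qone : quad := (1, 0).
Fact qmulA : associative qmul.
Proof. by case=> a b [c e] [f g]; apply: injective_projections; rewrite /qmul /=; ring. Qed.
Fact qmulC : commutative qmul.
Proof. by case=> a b [c e]; apply: injective_projections; rewrite /qmul /=; ring. Qed.
Fact qmul1 : left_id qone qmul.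
Proof. by case=> a b; apply: injective_projections; rewrite /qmul /=; ring. Qed.
Fact qmulD : left_distributive qmul +%R.
Proof. by case=> a b [c e] [f g]; apply: injective_projections; rewrite /qmul /=; ring. Qed.
Fact qone0 : qone != 0.
Proof. by apply/eqP => -[] /eqP; rewrite oner_eq0. Qed.
HB.instance Definition _ :=
  GRing.Zmodule_isComNzRing.Build quad qmulA qmulC qmul1 qmulD qone0.
Definition qunit : {pred quad} := [pred x | [exists y : quad, y * x == 1]].
Definition qinv (x : quad) : quad :=
  if [pick y : quad | y * x == 1] is Some y then y else x.
Fact qmulV : {in qunit, left_inverse 1 qinv *%R}.
Proof.
move=> x; rewrite inE /qinv => /existsP[y Hy].
by case: pickP => [z /eqP //|/(_ y)]; rewrite Hy.
Qed.
Fact qunitP : forall x y : quad, y * x = 1 -> qunit x.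
Proof. by move=> x y Hy; apply/existsP; exists y; apply/eqP. Qed.
Fact qinv_out : {in [predC qunit], qinv =1 id}.
Proof. move=> x; rewrite inE /= inE /qinv; case: pickP => // y Hy /existsP[]; by exists y. Qed.
HB.instance Definition _ :=
  GRing.ComNzRing_hasMulInverse.Build quad qmulV qunitP qinv_out.

Definition qemb (a : R) : quad := (a, 0).
Definition qtheta : quad := (0, 1).
Definition qconj (x : quad) : quad := (x.1, - x.2).
Fact qconj_zmod : zmod_morphism qconj.
Proof. by case=> a b [c e]; apply: injective_projections => /=; ring. Qed.
HB.instance Definition _ := GRing.isZmodMorphism.Build quad quad qconj qconj_zmod.
Fact qconj_monoid : monoid_morphism qconj.
Proof.
split; first by apply: injective_projections => /=; rewrite ?oppr0.
by case=> a b [c e]; apply: injective_projections; rewrite /= /qmul /=; ring.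
Qed.
HB.instance Definition _ := GRing.isMonoidMorphism.Build quad quad qconj qconj_monoid.
End Quad.


Notation quad := quad_of.


Section Groups.
Variable S : finComUnitRingType.

Definition Wmx : 'M[S]_2 := \matrix_(i < 2, j < 2) (if i != j then 1 else 0).

Lemma WmxK : Wmx *m Wmx = 1%:M.
Proof.
apply/matrixP=> i j; rewrite !mxE big_ord_recr big_ord1 /= !mxE.
by case: i => [[|[|//]] Hi]; case: j => [[|[|//]] Hj]; rewrite /= ?mulr0 ?mul0r ?mulr1 ?addr0 ?add0r.
Qed.

Lemma Wmx_unit : Wmx \in unitmx.
Proof. by case: (mulmx1_unit WmxK). Qed.

Definition star (c : {rmorphism S -> S}) (A : 'M[S]_2) : 'M[S]_2 :=
  Wmx *m (map_mx c A)^T *m invmx Wmx.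

Lemma starM c (A B : 'M[S]_2) : star c (A *m B) = star c B *m star c A.
Proof.
rewrite /star map_mxM trmx_mul !mulmxA; congr (_ *m _).
by rewrite -!mulmxA; congr (_ *m _); rewrite !mulmxA mulmxKV ?Wmx_unit.
Qed.

Lemma star1 c : star c 1%:M = 1%:M.
Proof. by rewrite /star map_mx1 trmx1 mulmx1 mulmxV ?Wmx_unit. Qed.

Definition GUset (c : {rmorphism S -> S}) : {set {'GL_2[S]}} :=
  [set g : {'GL_2[S]} | star c (GLval g) *m GLval g == 1%:M].

Lemma GUset_group c : group_set (GUset c).
Proof.
apply/group_setP; split; first by rewrite inE GL_1E star1 mul1mx.
move=> x y; rewrite !inE => /eqP Hx /eqP Hy.
by rewrite GL_MxE starM -mulmxA [X in _ *m X]mulmxA Hx mul1mx Hy.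
Qed.
Canonical GUgroup c := Group (GUset_group c).

Definition rdvdb (m x : S) : bool := [exists y : S, x == m * y].

Lemma rdvdb0 m : rdvdb m 0.
Proof. by apply/existsP; exists 0; rewrite mulr0. Qed.
Lemma rdvdbD m x y : rdvdb m x -> rdvdb m y -> rdvdb m (x + y).
Proof.
move=> /existsP[a /eqP->] /existsP[b /eqP->]; apply/existsP; exists (a + b).
by rewrite mulrDr.
Qed.
Lemma rdvdbMr m x y : rdvdb m x -> rdvdb m (x * y).
Proof. by move=> /existsP[a /eqP->]; apply/existsP; exists (a * y); rewrite mulrA. Qed.
Lemma rdvdbMl m x y : rdvdb m y -> rdvdb m (x * y).
Proof. by rewrite mulrC; apply: rdvdbMr. Qed.

Definition Kset (pi : S) (i : nat) : {set {'GL_2[S]}} :=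
  [set g : {'GL_2[S]} |
     [forall a : 'I_2, forall b : 'I_2, rdvdb (pi ^+ i) ((GLval g - 1%:M) a b)]].

Lemma Kset_group pi i : group_set (Kset pi i).
Proof.
apply/group_setP; split.
  by rewrite inE; apply/forallP=> a; apply/forallP=> b; rewrite GL_1E subrr mxE rdvdb0.
move=> x y; rewrite !inE => /forallP Hx /forallP Hy.
apply/forallP=> a; apply/forallP=> b.
have -> : GLval (x * y) - 1%:M = (GLval x - 1%:M) *m GLval y + (GLval y - 1%:M).
  by rewrite GL_MxE mulmxBl mul1mx addrA subrK.
move: (GLval x - 1%:M) (GLval y - 1%:M) Hx Hy => X' Y' HX HY.
rewrite mxE; apply: rdvdbD; last by have /forallP := HY a; apply.
rewrite mxE; apply: (big_ind (rdvdb (pi ^+ i))); [exact: rdvdb0| exact: rdvdbD|] => k _.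
by apply: rdvdbMr; have /forallP := HX a; apply.
Qed.
Canonical Kgroup pi i := Group (Kset_group pi i).

Definition Atil (eps : S) : 'M[S]_2 :=
  \matrix_(i < 2, j < 2) (if (i == 1 :> nat) && (j == 0 :> nat) then eps else 0).

(* psi_A (I + pi^{l2} B) = psi (pi^{l2} tr(A~ B)) = psi (tr (A~ (g - I))) *)
Definition psiA (psi : S -> algC) (eps : S) (g : {'GL_2[S]}) : algC :=
  psi (\tr (Atil eps *m (GLval g - 1%:M))).

(* "the restriction of chi to K contains phi", i.e. <Res_K chi, phi>_K != 0,
   with the inner product written out (up to the nonzero factor 1/|K|) *)
Definition res_contains (G : {group {'GL_2[S]}}) (K : {set {'GL_2[S]}})
  (chi : 'CF(G)) (phi : {'GL_2[S]} -> algC) : Prop :=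
  \sum_(k in K) chi k * (phi k)^* != 0.

Definition thm92_concl (G : {group {'GL_2[S]}}) (piS : S) (l : nat) (eps : S)
  (psi : S -> algC) (q : nat) : Prop :=
  let l1 := l./2 in
  let l2 := (l - l1)%N in
  let K := (G :&: Kset piS l2)%G in
  forall i1 i2 : Iirr G,
    res_contains K 'chi_i1 (psiA psi eps) ->
    res_contains K 'chi_i2 (psiA psi eps) ->
    exists j : Iirr G,
      res_contains K 'chi_j (psiA psi eps) /\
      (q%:R - 2) * (q%:R : algC) ^ ((l1./2 + l1)%N%:Z - l2%:Z - 1)
        <= '['chi_i1 * 'chi_i2, 'chi_j].

End Groups.

Definition add_char_nontriv (S : comPzRingType) (psi : S -> algC) (m : S) : Prop :=
  [/\ psi 0 = 1, (forall x y, psi (x + y) = psi x * psi y) &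
      exists x, psi (m * x) != 1].

(* Main.v *)
Require Import Defs.
From HB Require Import structures.
From mathcomp Require Import all_boot all_order all_algebra all_fingroup all_solvable all_field all_character.
From mathcomp Require Import ring zify.
Set Implicit Arguments. Unset Strict Implicit. Unset Printing Implicit Defensive.
Import Order.TTheory GRing.Theory Num.Theory.
Local Open Scope ring_scope.

(** Write [lam = psi_A], [K = K^{l2}], [e_rho = <rho|_K, lam>]. By Clifford theory
    [<rho_1 rho_2|_K, lam> = e_1 e_2 M], where [M] is the number of ways to write [lam] as a
    product of two [G]-conjugates of itself; this is also [\sum_rho <rho_1 rho_2, rho> e_rho].
    All the [rho] in this sum have the same central character, so they lie over a single
    character of [Z(G) K], whence [\sum_rho e_rho^2 <= [I_G(lam) : Z(G) K]]. Some [rho] over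
    [lam] therefore has multiplicity at least [e_1 e_2 M / [I_G(lam) : Z(G) K]]. Then
    - [[I_G(lam) : Z(G) K] <= q^(3 l2 - 2 l1)];
    - [M >= (q - 2) q^(l1 - 1 + l1/2)], since [A = X + (A - X)] with both summands conjugate to
      [A] for [X = ((x, 0), (z, -x))] (up to powers of [eps]), [x^2 = 0], [z] and [1 - z] units;
    - [e_i >= q^(l2 - l1)], since the commutator pairing induced by [lam] on [K^{l1} / K^{l2}]
      has a radical of index [q^(2 (l2 - l1))]. *)

(** * Clifford theory *)

(** The exponents balance with nothing to spare: 2 (l2 - l1) from e_1 e_2, plus l1 - 1 + l1/2 from
    M, minus 3 l2 - 2 l1 from the index, is l1/2 + l1 - l2 - 1. This is why the centre enters: over
    all rho containing lam the sum of e_rho^2 is [I_G(lam) : K], and the extra factor [Z(G) K : K]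
    would spoil the bound. The estimate of e_i has content only for odd l, where l2 = l1 + 1 and it
    gives e_i >= q. In M, the factor q - 2 counts the residue classes of z other than 0 and 1, and
    q^(l1/2) counts the x modulo p^l1 divisible by p^(l1 - l1/2), for which x^2 = 0. Both groups are
    treated at once by working with the four entries of a matrix; psi_A sees only the upper right
    one, since A has a single nonzero entry. What distinguishes GU_2 is which ratios of entries lie
    in the base ring and which in [eps] times it, and the supply of diagonal elements, which rests
    on norms and on square roots of elements close to 1. *)

Section CharacterTheory.
Variable gT : finGroupType.
Implicit Types G H K Z T : {group gT}.

Lemma char_cfcenterM G (chi : 'CF(G)) x z :
  chi \is a character -> x \in G -> z \in 'Z(chi)%CF ->
  chi (x * z)%g * chi 1%g = chi x * chi z.
Proof.
move/char_reprP=> [rG ->] Gx; rewrite cfcenter_repr.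
move=> /setIdP[Gz /is_scalar_mxP[c rGc]].
rewrite !cfunE Gx Gz group1 groupM // !mulr1n repr_mxM // rGc repr_mx1.
by rewrite mul_mx_scalar mxtraceZ !mxtrace_scalar -[c *+ _]mulr_natr mulrA [c * _]mulrC.
Qed.

(** Schur's lemma for characters. The translation formula is what allows inner products over Z K to
    be computed on K. *)
Lemma irr_central_lin G Z (i : Iirr G) : Z \subset 'Z(G)%g ->
  exists2 zeta : 'CF(Z), zeta \is a linear_char &
    'Res[Z] 'chi_i = 'chi_i 1%g *: zeta
    /\ {in G & Z, forall x z, 'chi_i (x * z)%g = 'chi_i x * zeta z}.
Proof.
move=> sZ; have sZi : Z \subset 'Z('chi_i)%CF.
  by apply: (subset_trans sZ); rewrite -cap_cfcenter_irr; apply: bigcap_inf.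
have sZG := subset_trans sZ (center_sub G).
have [xi Lxi def_xi] := cfcenter_Res 'chi_i.
have resE : 'Res[Z] 'chi_i = 'chi_i 1%g *: 'Res[Z] xi.
  by rewrite -linearZ /= -def_xi cfResRes // cfcenter_sub.
exists ('Res[Z] xi); first by apply: cfRes_lin_char.
split=> // x z Gx Zz; apply: (mulIf (irr1_neq0 i)).
rewrite char_cfcenterM ?irr_char // ?(subsetP sZi) //.
have := congr1 (fun phi : 'CF(Z) => phi z) resE.
by rewrite cfResE // [X in _ = X]cfunE => ->; rewrite -mulrA; congr (_ * _); rewrite mulrC.
Qed.

Lemma lin_char_dot_irr G (a : algC) (zeta : 'CF(G)) (j : Iirr G) :
  zeta \is a linear_char -> '[a *: zeta, 'chi_j] != 0 -> zeta = 'chi_j.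
Proof.
move/lin_char_irr/irrP=> [i ->]; rewrite cfdotZl cfdot_irr.
by case: (i =P j) => [->|_] //; rewrite mulr0 eqxx.
Qed.

(** By Frobenius reciprocity the norm counts the conjugates of ['chi_t] in the restriction of the
    induced character that equal ['chi_t] itself. *)
Lemma cfnorm_Ind_irr_normal T G (t : Iirr T) : (T <| G)%g ->
  '['Ind[G] 'chi_t] = #|('I_G['chi_t]%g : {set gT}) : T|%g%:R.
Proof.
move=> nTG; rewrite -Frobenius_reciprocity cfResInd // cfdotZr cfdot_sumr.
rewrite (eq_bigr (fun y => (y \in 'I_G['chi_t]%g)%:R)); last first.
  by move=> y Gy; rewrite (cfdot_irr_conjg _ nTG).
rewrite -natr_sum -big_mkcondr /= sum1dep_card.
rewrite (_ : [set _ | _] = 'I_G['chi_t]%g); last first.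
  by apply/setP=> y; rewrite !inE; case: (y \in G).
rewrite fmorphV /= conjC_nat -(LagrangeI 'I_G['chi_t]%G T).
rewrite (setIidPr (sub_Inertia _ (normal_sub nTG))).
by rewrite natrM mulKf // pnatr_eq0 -lt0n cardG_gt0.
Qed.

(** Both averages equal that of [f (t * k)] over all pairs: writing t = z k0, the factor z drops out
    by invariance and k0 only permutes K. It will be applied to a product of two characters whose
    central factors cancel. *)
Lemma average_translate K T Z (f : gT -> algC) :
  K \subset T -> T \subset (Z * K)%g -> Z \subset 'C(K)%g ->
  {in Z & T, forall z t, f (t * z)%g = f t} ->
  #|K|%:R^-1 * (\sum_(k in K) f k) = #|T|%:R^-1 * (\sum_(t in T) f t).
Proof.
move=> sKT sTZK cZK fZ.
have nz (H : {group gT}) : #|H|%:R != 0 :> algC by rewrite pnatr_eq0 -lt0n cardG_gt0.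
suff E : #|T|%:R * (\sum_(k in K) f k) = #|K|%:R * (\sum_(t in T) f t).
  apply: (mulfI (nz T)); rewrite mulrCA E mulKf ?nz //.
  by rewrite mulVKf ?nz.
transitivity (\sum_(t in T) \sum_(k in K) f (t * k)%g).
  rewrite mulr_natl -sumr_const; apply: eq_bigr => t Tt.
  have /mulsgP[z k0 Zz Kk0 ->] := subsetP sTZK t Tt.
  rewrite (reindex_inj (mulgI k0)) /=.
  apply: eq_big => [k|k Kk]; first by rewrite groupMl.
  rewrite groupMl // in Kk.
  have Kkk : (k0 * k)%g \in K by rewrite groupM.
  rewrite -mulgA (centP (subsetP cZK z Zz) _ Kkk) fZ //.
  exact: (subsetP sKT).
rewrite exchange_big /= mulr_natl -sumr_const; apply: eq_bigr => k Kk.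
rewrite [RHS](reindex_inj (mulIg k)) /=.
by apply: eq_bigl => t; rewrite groupMr // (subsetP sKT).
Qed.

(** At an index of A where m is largest, N <= max m * \sum e <= max m * \sum e^2, because the e are
    integers. Positivity of N ensures that A has an element. *)
Lemma sum_mul_le_max (I : finType) (A : {pred I}) (m e : I -> nat) N B :
  (forall i, i \notin A -> m i * e i = 0)%N ->
  (0 < N)%N -> (N <= \sum_i m i * e i)%N -> (\sum_(i in A) e i ^ 2 <= B)%N ->
  exists2 i, i \in A & (N <= m i * B)%N.
Proof.
move=> outA N0 leN leB.
have [i0 Ai0] : exists i, i \in A.
  apply/existsP; apply: contraTT N0 => /existsPn nA.
  by rewrite -leqNgt (leq_trans leN) // big1 // => i _; rewrite outA.
case: (arg_maxnP m Ai0) => i Ai maxi; exists i => //.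
apply: (leq_trans leN); rewrite (bigID (mem A)) /= [X in (_ + X)%N]big1; last first.
  by move=> j nAj; rewrite outA.
rewrite addn0 (leq_trans _ (leq_mul (leqnn (m i)) leB)) // big_distrr leq_sum //= => j Aj.
apply: leq_mul; first exact: maxi.
by case: (e j) => // n; rewrite expnS expn1 leq_pmulr.
Qed.

Section Clifford.
Variables (G K : {group gT}) (j : Iirr K).
Hypothesis nKG : (K <| G)%g.
Local Notation lam := ('chi_j).
Let Z : {group gT} := 'Z(G)%G.
Let T : {group gT} := (Z <*> K)%G.

Let nZG : (Z <| G)%g. Proof. exact: center_normal. Qed.
Let nTG : (T <| G)%g. Proof. exact: normalY. Qed.
Let sKG := normal_sub nKG.
Let sZT : Z \subset T. Proof. exact: joing_subl. Qed.
Let sKT : K \subset T. Proof. exact: joing_subr. Qed.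
Let sTG := normal_sub nTG.
Let cZG : Z \subset 'C(G)%g. Proof. exact: subsetIr. Qed.
Let cZK : Z \subset 'C(K)%g. Proof. exact: subset_trans cZG (centS sKG). Qed.
Let sTZK : T \subset (Z * K)%g.
Proof. by rewrite /= cent_joinEl. Qed.
Let sZZT : Z \subset 'Z(T)%g.
Proof. by rewrite subsetI sZT (subset_trans cZG) // centS. Qed.

Definition lmult (i : Iirr G) : algC := '['Res[K] 'chi_i, lam].

Lemma lmult_nat i : lmult i \is a Num.nat.
Proof. by rewrite Cnat_cfdot_char_irr // cfRes_char // irr_char. Qed.

(* The constituents of [Phi] over [lam] all lie over one character ['chi_t] of [T = Z K]. *)
Lemma sum_sqr_lmult (Phi : 'CF(G)) (zeta : 'CF(Z)) : Phi \is a character ->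
  zeta \is a linear_char -> 'Res[Z] Phi = Phi 1%g *: zeta ->
  \sum_(i in irr_constt Phi) lmult i ^+ 2 <= #|('I_G[lam]%g : {set gT}) : T|%g%:R.
Proof.
move=> cPhi Lzeta resPhi.
(* The central character of a constituent of [Phi] is a constituent of ['Res[Z] Phi], a multiple of
   [zeta], so it is [zeta]. *)
have centE (i : Iirr G) : i \in irr_constt Phi ->
    {in G & Z, forall x z, 'chi_i (x * z)%g = 'chi_i x * zeta z}.
  move=> Phi_i; have [xi Lxi [resi mulE]] := irr_central_lin i (subxx Z).
  suff -> : zeta = xi by [].
  have /irrP[t xiE] := lin_char_irr Lxi; rewrite xiE.
  apply: (@lin_char_dot_irr _ (Phi 1%g)) => //; rewrite -resPhi.
  apply: (constt_Res_trans cPhi Phi_i).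
  rewrite irr_consttE resi xiE cfdotZl cfdot_irr eqxx mulr1.
  exact: irr1_neq0.
have [/existsP[i0 /andP[Phi_i0 nz0]]|/existsPn none] :=
    boolP [exists i, (i \in irr_constt Phi) && (lmult i != 0)]; last first.
  rewrite big1 ?ler0n // => i Phi_i; have := none i.
  by rewrite Phi_i /= negbK => /eqP->; rewrite expr0n.
have [t ti0 tj] : exists2 t : Iirr T, t \in irr_constt ('Res[T] 'chi_i0)
    & j \in irr_constt ('Res[K] 'chi_t).
  apply/exists_inP; apply: contraNT nz0 => /exists_inPn none.
  rewrite /lmult -(cfResRes _ sKT sTG) (cfun_sum_constt ('Res[T] _)).
  rewrite linear_sum cfdot_suml big1 // => t tt.
  rewrite linearZ /= cfdotZl; have := none t tt.
  by rewrite irr_consttE negbK => /eqP->; rewrite mulr0.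
have phiZ : {in T & Z, forall x z, 'chi_t (x * z)%g = 'chi_t x * zeta z}.
  have [xi Lxi [resi mulE]] := irr_central_lin t sZZT.
  suff -> : zeta = xi by [].
  have /irrP[s xiE] := lin_char_irr Lxi; rewrite xiE.
  apply: (@lin_char_dot_irr _ (Phi 1%g)) => //; rewrite -resPhi.
  apply: (constt_Res_trans cPhi Phi_i0).
  rewrite -(cfResRes _ sZT sTG).
  apply: (constt_Res_trans _ ti0); first by rewrite cfRes_char ?irr_char.
  rewrite irr_consttE resi xiE cfdotZl cfdot_irr eqxx mulr1.
  exact: irr1_neq0.
(* Both characters lie over [zeta], so their inner products over T and over K agree; and ['Res[K]
   'chi_t] is [lam] plus a character. *)
have le_e i : i \in irr_constt Phi -> lmult i <= '['Res[T] 'chi_i, 'chi_t].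
  move=> Phi_i; have -> : '['Res[T] 'chi_i, 'chi_t] = '['Res[K] 'chi_i, 'Res[K] 'chi_t].
    rewrite !cfdotE.
    rewrite (eq_bigr (fun x => 'chi_i x * ('chi_t x)^*)); last first.
      by move=> x Tx; rewrite cfResE.
    rewrite -(@average_translate K T Z) //; last first.
      move=> z x Zz Tx; rewrite phiZ // centE ?(subsetP sTG) // rmorphM /=.
      by rewrite mulrACA -normCK (normC_lin_char Lzeta Zz) expr1n mulr1.
    by congr (_ * _); apply: eq_bigr => x Kx; rewrite !cfResE.
  have cK : 'Res[K] 'chi_i \is a character by rewrite cfRes_char ?irr_char.
  have /constt_charP[|theta ctheta ->] := tj; first by rewrite cfRes_char ?irr_char.
  by rewrite cfdotDr lerDl natr_ge0 // Cnat_cfdot_char.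
(* The norm of the induced character is the sum of the squares of its multiplicities; those outside
   [Phi] are dropped. *)
apply: (@le_trans _ _ ('['Ind[G] 'chi_t])).
  rewrite cfdot_sum_irr [leRHS](bigID (mem (irr_constt Phi))) /= -[leLHS]addr0 lerD //.
    apply: ler_sum => i Phi_i.
    rewrite -normCK -Frobenius_reciprocity cfdotC norm_conjC.
    have ge0 : 0 <= lmult i by rewrite natr_ge0 ?lmult_nat.
    have le1 := le_e i Phi_i.
    by rewrite ger0_norm ?(le_trans ge0) // !expr2 ler_pM.
  by apply: sumr_ge0 => i _; rewrite -normCK exprn_ge0.
rewrite cfnorm_Ind_irr_normal // ler_nat.
apply/subset_leq_card/imsetS.
(* Since T = Z K fixes [lam], the restriction of ['chi_t] to K is a multiple of [lam], so whatever
   fixes ['chi_t] fixes [lam]. *)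
have -> : 'I_G[lam]%g = 'I_G['Res[K] 'chi_t]%g.
  have nKT : (K <| T)%g by rewrite (normalS sKT sTG).
  have sTI : T \subset 'I[lam]%g.
    by rewrite join_subG sub_inertia (subset_trans cZK) // cent_sub_inertia.
  rewrite (Clifford_Res_sum_cfclass nKT tj) cfclass_invariant // big_seq1.
  by rewrite inertia_scale_nz // -irr_consttE.
exact/sub_inertia_Res/normal_norm.
Qed.

(** By Clifford's theorem each factor restricts to its multiplicity times the orbit sum of [lam].
    The product of two orbit sums contains [lam] once for every pair [mu x], [mu' x]; a family [Om]
    of such pairs is enough because only a lower bound is wanted. *)
Lemma tensor_multiplicity (I : finType) (Om : {set I}) (mu mu' : I -> 'CF(K))
    (i1 i2 : Iirr G) :
  lmult i1 != 0 -> lmult i2 != 0 -> (0 < #|Om|)%N ->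
  {in Om &, injective mu} ->
  (forall x, x \in Om -> [/\ mu x \in cfclass lam G, mu' x \in cfclass lam G
                           & mu x * mu' x = lam]) ->
  exists2 i, lmult i != 0 &
    lmult i1 * lmult i2 * #|Om|%:R <=
      '['chi_i1 * 'chi_i2, 'chi_i] * #|('I_G[lam]%g : {set gT}) : 'Z(G) <*> K|%g%:R.
Proof.
move=> nz1 nz2 Om0 injmu muP.
set Phi := 'chi_i1 * 'chi_i2.
have cPhi : Phi \is a character by rewrite rpredM ?irr_char.
have [z1 Lz1 [res1 _]] := irr_central_lin i1 (subxx Z).
have [z2 Lz2 [res2 _]] := irr_central_lin i2 (subxx Z).
have resPhi : 'Res[Z] Phi = Phi 1%g *: (z1 * z2).
  by rewrite rmorphM /= res1 res2 cfunE -scalerAl -scalerAr scalerA.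
have bound := sum_sqr_lmult cPhi (rpredM Lz1 Lz2) resPhi.
have natm i : '[Phi, 'chi_i] \is a Num.nat by rewrite Cnat_cfdot_char_irr.
pose m i := Num.truncn '[Phi, 'chi_i]; pose e i := Num.truncn (lmult i).
have mE i : (m i)%:R = '[Phi, 'chi_i] by rewrite Num.Theory.truncnK.
have eE i : (e i)%:R = lmult i by rewrite Num.Theory.truncnK ?lmult_nat.
have NE : (\sum_i m i * e i)%N%:R = '['Res[K] Phi, lam].
  rewrite [in RHS](cfun_sum_cfdot Phi) linear_sum cfdot_suml natr_sum.
  by apply: eq_bigr => i _; rewrite linearZ cfdotZl natrM mE eE.
have lowN : (e i1 * e i2 * #|Om| <= \sum_i m i * e i)%N.
  rewrite -(ler_nat algC) NE !natrM !eE rmorphM /=.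
  rewrite (Clifford_Res_sum_cfclass nKG nz1) (Clifford_Res_sum_cfclass nKG nz2).
  rewrite -scalerAl -scalerAr scalerA cfdotZl ler_wpM2l //.
    by rewrite mulr_ge0 // natr_ge0 // lmult_nat.
  have chL xi : xi \in cfclass lam G -> xi \is a character.
    by case/cfclassP=> y _ ->; rewrite cfConjg_char ?irr_char.
  rewrite mulr_suml cfdot_suml.
  have ge0 xi : xi \in cfclass lam G ->
     0 <= '[xi * (\sum_(chi <- cfclass lam G) chi), lam].
    move=> /chL xiL; rewrite natr_ge0 // Cnat_cfdot_char_irr // rpredM //.
    by rewrite big_seq_cond rpred_sum // => chi /andP[/chL].
  (* Orbit elements outside the image of [mu] contribute nonnegative amounts and are discarded; for
     [mu x], only the partner [mu' x] is kept. *)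
  rewrite big_seq (bigID [pred xi | xi \in [seq mu x | x <- enum Om]]) /=.
  rewrite -[leLHS]addr0 lerD //; last first.
    by apply: sumr_ge0 => xi /andP[/ge0].
  have uOm : uniq [seq mu x | x <- enum Om].
    by rewrite map_inj_in_uniq ?enum_uniq // => x y; rewrite !mem_enum; apply: injmu.
  rewrite -big_seq_cond -big_filter.
  rewrite (perm_big [seq mu x | x <- enum Om]); last first.
    apply: uniq_perm; rewrite ?filter_uniq ?cfclass_uniq // => xi.
    rewrite !mem_filter.
    apply/idP/idP=> [/andP[]//|xiO]; rewrite xiO /=.
    by have /mapP[x] := xiO; rewrite mem_enum => /muP[h _ _] ->; rewrite h.
  rewrite big_map big_enum /= -sum1_card natr_sum.
  apply: ler_sum => x /muP[h1 h2 h3].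
  rewrite (big_rem (mu' x)) //= mulrDr h3 cfdotDl cfdot_irr eqxx lerDl.
  rewrite natr_ge0 // Cnat_cfdot_char_irr // rpredM //; first exact: chL.
  rewrite big_seq_cond rpred_sum // => chi /andP[/mem_rem/chL //].
have e0 i : lmult i != 0 -> (0 < e i)%N.
  by move=> nz; rewrite lt0n -(pnatr_eq0 algC) eE.
(* The condition on [lmult] makes the maximising representation lie over [lam]. *)
pose A := [pred i | (i \in irr_constt Phi) && (lmult i != 0)].
have [|||i Ai le] := @sum_mul_le_max _ A m e (e i1 * e i2 * #|Om|)
     #|('I_G[lam]%g : {set gT}) : 'Z(G) <*> K|%g _ _ lowN.
- move=> i; rewrite inE negb_and !negbK => /orP[]/eqP h; apply/eqP.
    by rewrite -(pnatr_eq0 algC) natrM mE h mul0r.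
  by rewrite -(pnatr_eq0 algC) natrM eE h mulr0.
- by rewrite !muln_gt0 !e0.
- rewrite -(ler_nat algC); apply: le_trans bound.
  rewrite natr_sum big_mkcond [leRHS]big_mkcond ler_sum // => i _.
  rewrite -[i \in A]/((i \in irr_constt Phi) && (lmult i != 0)).
  by rewrite natrX eE; case: (i \in irr_constt Phi) => //=; case: eqP => [->|_] //=; rewrite expr0n.
have /andP[_ nzi] := Ai.
by exists i => //; rewrite -mE -!eE -!natrM ler_nat.
Qed.

(** Take a constituent ['chi_t] of the restriction to H lying over [lam]. As K is central in H,
    ['chi_t] is ['chi_t 1] times [lam] on K, so its degree is at most [lmult i]. It vanishes off D,
    since conjugating h by x multiplies its value by [lam [~ h, x]]. Its norm being 1, |H| is at
    most |D| times the squared degree. *)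
Lemma lmult_lower_bound (H : {group gT}) (D : {set gT}) (i : Iirr G) :
  K \subset H -> H \subset G -> H \subset 'C(K)%g ->
  {in H &, forall h x, [~ h, x]%g \in K} ->
  {in H, forall h, h \notin D -> exists2 x, x \in H & lam [~ h, x]%g != 1} ->
  lmult i != 0 -> #|H|%:R <= #|D|%:R * lmult i ^+ 2.
Proof.
move=> sKH sHG cHK comm sep nz.
have [t ti tj] : exists2 t : Iirr H, t \in irr_constt ('Res[H] 'chi_i)
    & j \in irr_constt ('Res[K] 'chi_t).
  apply/exists_inP; apply: contraNT nz => /exists_inPn none.
  rewrite /lmult -(cfResRes _ sKH sHG) (cfun_sum_constt ('Res[H] _)).
  rewrite linear_sum cfdot_suml big1 // => t tt.
  rewrite linearZ /= cfdotZl; have := none t tt.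
  by rewrite irr_consttE negbK => /eqP->; rewrite mulr0.
have sKZ : K \subset 'Z(H)%g by rewrite subsetI sKH centsC.
have [xi Lxi [resi mulE]] := irr_central_lin t sKZ.
have xiE : xi = lam by apply: (@lin_char_dot_irr _ ('chi_t 1%g)) => //; rewrite -resi.
have le1 : 'chi_t 1%g <= lmult i.
  rewrite /lmult -(cfResRes _ sKH sHG).
  have cR : 'Res[H] 'chi_i \is a character by rewrite cfRes_char ?irr_char.
  apply: le_trans (cfdot_Res_ge_constt j cR ti).
  by rewrite resi xiE cfdotZl cfdot_irr eqxx mulr1.
have van h : h \in H -> h \notin D -> 'chi_t h = 0.
  move=> Hh nD; have [x Hx] := sep h Hh nD.
  apply: contraNeq => nzh; apply/eqP/(mulfI nzh).
  by rewrite mulr1 -xiE -mulE ?comm // -conjg_mulR cfunJ.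
have ge0 : 0 <= 'chi_t 1%g := char1_ge0 (irr_char t).
apply: (@le_trans _ _ (#|D|%:R * 'chi_t 1%g ^+ 2)); last first.
  by rewrite ler_wpM2l ?ler0n // lerXn2r // nnegrE // (le_trans ge0).
have : '['chi_t] = 1 by rewrite cfdot_irr eqxx.
rewrite cfdotE => E.
have -> : #|H|%:R = \sum_(x in H) 'chi_t x * ('chi_t x)^* :> algC.
  have nzH : #|H|%:R != 0 :> algC by rewrite pnatr_eq0 -lt0n cardG_gt0.
  by apply: (mulfI (invr_neq0 nzH)); rewrite E mulVf.
rewrite (bigID (mem D)) /= [X in _ + X]big1 ?addr0; last first.
  by move=> x /andP[Hx nD]; rewrite van // mul0r.
rewrite mulr_natl -sumr_const big_mkcond [leRHS]big_mkcond ler_sum // => x _.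
case: (boolP (x \in D)) => Dx; last by rewrite andbF.
rewrite andbT; case: ifP => _; last by rewrite exprn_ge0.
by rewrite -normCK lerXn2r ?nnegrE // char1_ge_norm // irr_char.
Qed.

End Clifford.
End CharacterTheory.

(** * Finite chain rings *)

Definition pideal (R : finComUnitRingType) (p : R) (i : nat) : {set R} :=
  [set x | rdvdb (p ^+ i) x].

Lemma pidealP (R : finComUnitRingType) (p : R) i x :
  reflect (exists y, x = p ^+ i * y) (x \in pideal p i).
Proof. by rewrite inE; apply: (iffP existsP) => -[y]; [move/eqP|]; exists y => //; apply/eqP. Qed.

(* By [chain_ann], congruence modulo [p ^+ (l - i)] is tested by multiplying by [p ^+ i]; this is how congruences are stated below. *)
Record chain_ring (R : finComUnitRingType) (p : R) (l q : nat) : Prop := ChainRing {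
  chain_nil : p ^+ l = 0;
  chain_fact : forall x : R, exists k u, u \is a GRing.unit /\ x = u * p ^+ k;
  chain_ann : forall i x, (i <= l)%N -> p ^+ i * x = 0 -> exists y, x = p ^+ (l - i) * y;
  chain_card : forall i, (i <= l)%N -> #|pideal p i| = (q ^ (l - i))%N;
  chain_q : odd q && (2 < q)%N }.

Lemma quotient_chain_ring (O : idomainType) (pi : O) (q l : nat)
    (R : finComUnitRingType) (f : {rmorphism O -> R}) :
  complete_dvr pi -> residue_card pi q -> odd q -> is_quotient_pow pi l f ->
  chain_ring (f pi) l q.
Proof.
move=> [nz_pi nu_pi fact _] [r [r_inj r_sur]] oddq [f_sur f_ker].
have nil : f pi ^+ l = 0 by rewrite -rmorphXn; apply/f_ker; exists 1; rewrite mulr1.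
have nzX k : pi ^+ k != 0 by rewrite expf_neq0.
have ann i x : (i <= l)%N -> f pi ^+ i * x = 0 -> exists y, x = f pi ^+ (l - i) * y.
  move=> le; have [y <-] := f_sur x; rewrite -rmorphXn -rmorphM => /f_ker[w].
  rewrite -(subnKC le) exprD -mulrA => /(mulfI (nzX i)) ->.
  by exists (f w); rewrite rmorphM rmorphXn addKn.
split=> //.
- move=> x; have [y <-] := f_sur x; have [->|/fact[k [u [Uu ->]]]] := eqVneq y 0.
    by exists l, 1; rewrite unitr1 nil mulr0 rmorph0.
  by exists k, (f u); rewrite rmorph_unit // rmorphM rmorphXn.
- suff cardl k : (k <= l)%N -> #|pideal (f pi) (l - k)| = (q ^ k)%N.
    by move=> i le; rewrite -[in LHS](subKn le) cardl // leq_subr.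
  elim: k => [_|k IH lt].
    rewrite subn0 expn0; suff -> : pideal (f pi) l = [set 0] by rewrite cards1.
    apply/setP=> x; rewrite !inE; apply/existsP/eqP=> [[y /eqP->]|->].
      by rewrite nil mul0r.
    by exists 0; rewrite mulr0.
  have -> : (q ^ k.+1 = #|setX [set: 'I_q] (pideal (f pi) (l - k))|)%N.
    by rewrite cardsX cardsT card_ord (IH (ltnW lt)) expnS.
  set i := (l - k.+1)%N; have iE : (l - k = i.+1)%N by rewrite /i; lia.
  have il : (i < l)%N by rewrite /i; lia.
  (* Leading digits: an element of p^i R is p^i times a residue representative plus an element of
     p^(i+1) R, in a unique way. *)
  rewrite iE -(card_in_imset (f := fun jw : 'I_q * R => f pi ^+ i * f (r jw.1) + jw.2)).
    apply: eq_card => x; apply/pidealP/imsetP=> [[y ->]|[[j w] /setXP[_ /pidealP[v /= ->]] ->]].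
      have [y' <-] := f_sur y; have [j [v vE]] := r_sur y'.
      exists (j, f pi ^+ i.+1 * f v).
        by rewrite in_setX in_setT /=; apply/pidealP; exists (f v).
      rewrite /= exprSr -mulrA -mulrDr -rmorphM -rmorphD -vE; congr (_ * f _).
      by rewrite addrC subrK.
    by exists (f (r j) + f pi * v); rewrite mulrDr mulrA -exprSr.
  move=> [j w] [j' w'] /setXP[_ /pidealP[v /= ->]] /setXP[_ /pidealP[v' /= ->]] E.
  suff jj : j = j' by move: E; rewrite jj => /addrI ->.
  apply: r_inj; have [v1 vE] := f_sur v; have [v1' vE'] := f_sur v'.
  have : f (pi ^+ i * (r j - r j' + pi * (v1 - v1'))) = 0.
    rewrite !(rmorphM, rmorphD, rmorphN, rmorphXn) /= vE vE'.
    rewrite mulrDr mulrBr mulrA -exprSr mulrBr.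
    by rewrite addrACA E -opprD subrr.
  move=> /f_ker[u]; rewrite -[in RHS](subnKC (ltnW il)) exprD -mulrA => /(mulfI (nzX i)) E2.
  exists (pi ^+ (l - i).-1 * u - (v1 - v1')).
  rewrite mulrBr mulrA -exprS prednK ?subn_gt0 // -E2; ring.
(* The only odd value to exclude is 1, for which 0 and 1 would be congruent and [pi] a unit. *)
- rewrite oddq /=; case: q oddq r r_inj r_sur => [|[|[|q']]] //= _ r r_inj r_sur.
  have [i [a aE]] := r_sur 0; have [j [b bE]] := r_sur 1.
  case/negP: nu_pi; apply/unitrP; exists (b - a).
  have ij : i = j by rewrite !ord1.
  suff : pi * (b - a) = 1 by split; rewrite // mulrC.
  by rewrite mulrBr -bE -aE ij sub0r opprK subrK.
Qed.

Section ChainRing.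
Variables (R : finComUnitRingType) (p : R) (l q : nat).
Hypotheses (cR : chain_ring p l q) (l0 : (0 < l)%N).

Lemma card_chain : #|R| = (q ^ l)%N.
Proof.
rewrite -[in RHS](subn0 l) -(chain_card cR) //; apply: eq_card => x.
by apply/esym/pidealP; exists x; rewrite mul1r.
Qed.

Lemma chain_p_nunit : p \isn't a GRing.unit.
Proof.
apply/negP=> Up; have := chain_nil cR; move/(congr1 (fun x => x \is a GRing.unit)).
by rewrite unitrX // unitr0.
Qed.

Lemma chain_unitVp x : x \is a GRing.unit \/ exists y, x = p * y.
Proof.
have [[|k] [u [Uu ->]]] := chain_fact cR x; first by left; rewrite mulr1.
by right; exists (u * p ^+ k); rewrite exprS mulrCA.
Qed.

Lemma chain_unitE x : (x \is a GRing.unit) = (x \notin pideal p 1).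
Proof.
apply/idP/idP=> [Ux|].
  apply: contra chain_p_nunit => /pidealP[y yE]; move: Ux.
  by rewrite yE unitrM expr1 => /andP[].
by case: (chain_unitVp x) => // -[y ->] /pidealP[]; exists y.
Qed.

Lemma pideal1D x y : x \in pideal p 1 -> (x + y \is a GRing.unit) = (y \is a GRing.unit).
Proof.
move=> /pidealP[v ->]; rewrite !chain_unitE; congr (~~ _).
apply/pidealP/pidealP=> -[w wE].
  by exists (w - v); rewrite mulrBr -wE addrC addKr.
by exists (v + w); rewrite mulrDr -wE.
Qed.

Lemma chain_unit_ann i x : (i < l)%N -> p ^+ i * (x - 1) = 0 -> x \is a GRing.unit.
Proof.
move=> il /(chain_ann cR (ltnW il))[y xE].
rewrite -(subrK 1 x) pideal1D ?unitr1 // xE.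
by apply/pidealP; exists (p ^+ (l - i).-1 * y); rewrite mulrA -exprD add1n prednK ?subn_gt0.
Qed.

(** The additive group has odd order q^l, so doubling is injective, hence surjective. *)
Lemma chain_2unit : (2%:R : R) \is a GRing.unit.
Proof.
have /andP[oq _] := chain_q cR.
have inj2 : injective (fun x : R => 2%:R * x).
  move=> x y E; apply/eqP; rewrite -subr_eq0; apply/eqP.
  have {E} : (x - y) *+ 2 = 0 by rewrite -mulr_natl mulrBr E subrr.
  move: (x - y) => z z2.
  have zq : z *+ (q ^ l) = 0.
    have := @expg_cardG _ [set: R] z (in_setT z).
    by rewrite cardsT card_chain FinRing.zmodXgE.
  have : z *+ (q ^ l) = z.
    by rewrite -(odd_double_half (q ^ l)) oddX oq orbT mulrnDr -mul2n mulrnA z2 mul0rn addr0.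
  by rewrite zq.
have [g gK Kg] := injF_bij inj2.
by apply/unitrP; exists (g 1); rewrite mulrC Kg.
Qed.

(** Hensel's lemma by counting: squaring preserves the elements congruent to 1 modulo p^(l - j), and
    is injective there because x + y is congruent to 2, a unit. *)
Lemma chain_sqrt j z : (j < l)%N -> p ^+ j * (z - 1) = 0 ->
  exists2 w, p ^+ j * (w - 1) = 0 & w ^+ 2 = z.
Proof.
move=> jl zj; pose A := [set x | p ^+ j * (x - 1) == 0].
have inj : {in A &, injective (fun x => x ^+ 2)}.
  move=> x y; rewrite !inE => /eqP xj /eqP yj E.
  have U : x + y \is a GRing.unit.
    rewrite -(unitrMr _ chain_2unit).
    have -> : 2%:R * (x + y) = 2%:R * ((x - 1) + (y - 1)) + 2%:R * 2%:R by ring.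
    have /(chain_ann cR (ltnW jl))[v vE] : p ^+ j * (2%:R * ((x - 1) + (y - 1))) = 0.
      by rewrite mulrCA mulrDr xj yj addr0 mulr0.
    rewrite pideal1D ?unitrM ?chain_2unit // vE.
    by apply/pidealP; exists (p ^+ (l - j).-1 * v); rewrite mulrA -exprD add1n prednK ?subn_gt0.
  apply/eqP; rewrite -subr_eq0; apply/eqP/(mulIr U).
  by rewrite mul0r -subr_sqr E subrr.
have sA : [set x ^+ 2 | x in A] \subset A.
  apply/subsetP=> y /imsetP[x]; rewrite !inE => /eqP xA ->; apply/eqP.
  have -> : x ^+ 2 - 1 = (x - 1) * (x + 1) by ring.
  by rewrite mulrA xA mul0r.
have /eqP eA : [set x ^+ 2 | x in A] == A by rewrite eqEcard sA card_in_imset //=.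
have : z \in [set x ^+ 2 | x in A] by rewrite eA inE zj.
by case/imsetP=> w; rewrite inE => /eqP wA ->; exists w.
Qed.

(* Pigeonhole: the squares of units together with [p R] fill more than half of [R]. *)
Lemma chain_norm_surj (t z : R) : t \is a GRing.unit -> z \is a GRing.unit ->
  exists x y, x ^+ 2 - t * y ^+ 2 = z.
Proof.
move=> Ut Uz; have /andP[oq q2] := chain_q cR.
pose U := ~: pideal p 1.
have cp : #|pideal p 1| = (q ^ l.-1)%N by rewrite (chain_card cR) // subn1.
have cU : (#|U| + q ^ l.-1 = q ^ l)%N by rewrite -card_chain -cp addnC cardsC.
pose Sq := [set x ^+ 2 | x in U].
(* The fibres of squaring on units have at most two elements: in (y - x)(y + x) = 0 the factors
   differ by the unit 2x, so one of them is a unit. *)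
have cSq : (#|U| <= 2 * #|Sq|)%N.
  rewrite -sum1_card (partition_big_imset (fun x => x ^+ 2)) /= mulnC -sum_nat_const.
  apply: leq_sum => _ /imsetP[x xU ->].
  rewrite sum1dep_card (leq_trans _ (_ : #|[set x; - x]| <= 2)%N) //; last first.
    by rewrite cardsU1 cards1 addn1; case: (_ \notin _).
  apply/subset_leq_card/subsetP=> y; rewrite !inE => /andP[yU /eqP E].
  have : (y - x) * (y + x) = 0 by rewrite -subr_sqr E subrr.
  have Ux : x \is a GRing.unit by rewrite chain_unitE; move: xU; rewrite inE.
  case: (chain_unitVp (y - x)) => [Ud /(canRL (mulKr Ud))|[v vE]].
    by rewrite mulr0 => /eqP; rewrite addr_eq0 => ->; rewrite orbT.
  have Us : y + x \is a GRing.unit.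
    have -> : y + x = (y - x) + 2%:R * x by ring.
    by rewrite pideal1D ?unitrM ?chain_2unit // vE; apply/pidealP; exists v.
  by move=> /(canRL (mulrK Us)); rewrite mul0r => /eqP; rewrite subr_eq0 => ->.
pose S1 := Sq :|: pideal p 1.
have disj : [disjoint Sq & pideal p 1].
  apply/pred0P=> y /=; apply/negP=> /andP[/imsetP[x xU ->]]; apply/negP.
  by rewrite -chain_unitE unitrX // chain_unitE; move: xU; rewrite inE.
have cS1 : (#|R| < 2 * #|S1|)%N.
  rewrite cardsU (eqP (_ : Sq :&: pideal p 1 == set0)) ?setI_eq0 // cards0 subn0.
  rewrite cp card_chain -cU.
  have : (0 < q ^ l.-1)%N by rewrite expn_gt0 (ltn_trans _ q2).
  move: cSq; lia.
(* Two sets with more than half of the elements of R must meet; a common element solves the equation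
   modulo p. *)
pose S2 := [set z + t * s | s in S1].
have cS2 : #|S2| = #|S1| by apply: card_imset => a b /addrI /(mulrI Ut).
have : S1 :&: S2 != set0.
  apply: contraL cS1 => /eqP E; rewrite -leqNgt.
  have := cardsUI S1 S2; rewrite E cards0 addn0 cS2 addnn -mul2n => <-.
  by rewrite -cardsT subset_leq_card // subsetT.
case/set0Pn=> s /setIP[s1 /imsetP[s' s2 sE]].
have S1P a : a \in S1 -> exists x v, a = x ^+ 2 + p * v.
  rewrite inE => /orP[/imsetP[x _ ->]|/pidealP[v ->]].
    by exists x, 0; rewrite mulr0 addr0.
  by exists 0, v; rewrite expr0n add0r.
have [x [v xE]] := S1P _ s1; have [y [v' yE]] := S1P _ s2.
set z' := x ^+ 2 - t * y ^+ 2.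
have z'E : z' = p * (t * v' - v) + z by rewrite /z'; move: sE; rewrite xE yE => /(canRL (addrK _)) ->; ring.
have Uz' : z' \is a GRing.unit.
  by rewrite z'E pideal1D //; apply/pidealP; exists (t * v' - v).
(* The quotient is 1 modulo p, so scaling x and y by its square root makes the solution exact. *)
have [||w w1 wE] := @chain_sqrt l.-1 (z / z').
- by rewrite prednK.
- have -> : z / z' - 1 = p * - ((t * v' - v) / z').
    by apply: (mulIr Uz'); rewrite mulrBl mulrVK // mul1r mulrN mulNr mulrA mulrVK // z'E; ring.
  by rewrite mulrA -exprSr prednK // (chain_nil cR) mul0r.
exists (w * x), (w * y).
have -> : (w * x) ^+ 2 - t * (w * y) ^+ 2 = w ^+ 2 * z' by rewrite /z'; ring.
by rewrite wE mulrVK.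
Qed.
End ChainRing.

(** * Two by two matrices *)

Section GL2.
Variable S : finComUnitRingType.
Implicit Types g h k : {'GL_2[S]}.

Definition ga g : S := (GLval g : 'M[S]_2) 0 0.
Definition gb g : S := (GLval g : 'M[S]_2) 0 1.
Definition gc g : S := (GLval g : 'M[S]_2) 1 0.
Definition gd g : S := (GLval g : 'M[S]_2) 1 1.
Definition gD g : S := ga g * gd g - gb g * gc g.

Lemma forall_I2 (P : 'I_2 -> Prop) : P 0 -> P 1 -> forall i, P i.
Proof.
move=> P0 P1 [[|[|//]] Hi].
  by rewrite (_ : Ordinal Hi = 0) //; apply: val_inj.
by rewrite (_ : Ordinal Hi = 1) //; apply: val_inj.
Qed.

Lemma sum_I2 (F : 'I_2 -> S) : \sum_i F i = F 0 + F 1.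
Proof.
rewrite big_ord_recr big_ord1 /=; congr (F _ + F _); exact: val_inj.
Qed.

Lemma mulmx2E (A B : 'M[S]_2) i j : (A *m B) i j = A i 0 * B 0 j + A i 1 * B 1 j.
Proof. by rewrite mxE sum_I2. Qed.

Lemma gaM g h : ga (g * h)%g = ga g * ga h + gb g * gc h.
Proof. exact: mulmx2E. Qed.
Lemma gbM g h : gb (g * h)%g = ga g * gb h + gb g * gd h.
Proof. exact: mulmx2E. Qed.
Lemma gcM g h : gc (g * h)%g = gc g * ga h + gd g * gc h.
Proof. exact: mulmx2E. Qed.
Lemma gdM g h : gd (g * h)%g = gc g * gb h + gd g * gd h.
Proof. exact: mulmx2E. Qed.

Lemma ga1 : ga 1%g = 1. Proof. by rewrite /ga mxE. Qed.
Lemma gb1 : gb 1%g = 0. Proof. by rewrite /gb mxE. Qed.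
Lemma gc1 : gc 1%g = 0. Proof. by rewrite /gc mxE. Qed.
Lemma gd1 : gd 1%g = 1. Proof. by rewrite /gd mxE. Qed.

Lemma GL2_eq g h : ga g = ga h -> gb g = gb h -> gc g = gc h -> gd g = gd h -> g = h.
Proof.
move=> ea eb ec ed; apply/val_inj/matrixP.
by apply: forall_I2; apply: forall_I2.
Qed.

Lemma gDM g h : gD (g * h)%g = gD g * gD h.
Proof. rewrite /gD gaM gbM gcM gdM; ring. Qed.

Lemma gD_unit g : gD g \is a GRing.unit.
Proof.
have : gD g * gD g^-1%g = 1 by rewrite -gDM mulgV /gD ga1 gb1 gd1 gc1; ring.
by move=> E; apply/unitrP; exists (gD g^-1%g); rewrite mulrC E.
Qed.

Lemma GL2_exists (a b c d : S) : a * d - b * c \is a GRing.unit ->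
  exists g, [/\ ga g = a, gb g = b, gc g = c & gd g = d].
Proof.
set D := a * d - b * c => UD.
pose mk (x y z t : S) : 'M[S]_2 := \matrix_(i, j)
  (if i == 0 then if j == 0 then x else y else if j == 0 then z else t).
have mkE x y z t : [/\ mk x y z t 0 0 = x, mk x y z t 0 1 = y, mk x y z t 1 0 = z
    & mk x y z t 1 1 = t] by rewrite /mk !mxE.
have inv : mk a b c d *m mk (d / D) (- b / D) (- c / D) (a / D) = 1%:M.
  have [e1 e2 e3 e4] := mkE a b c d.
  have [f1 f2 f3 f4] := mkE (d / D) (- b / D) (- c / D) (a / D).
  apply/matrixP; apply: forall_I2; apply: forall_I2; rewrite mulmx2E ?e1 ?e2 ?e3 ?e4 ?f1 ?f2 ?f3 ?f4 !mxE /=.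
  - by apply: (mulIr UD); rewrite mulrDl !mulrA !mulrVK // /D; ring.
  - by apply: (mulIr UD); rewrite mulrDl !mulrA !mulrVK //; ring.
  - by apply: (mulIr UD); rewrite mulrDl !mulrA !mulrVK //; ring.
  - by apply: (mulIr UD); rewrite mulrDl !mulrA !mulrVK // /D; ring.
have [U _] := mulmx1_unit inv.
exists (FinRing.unit 'M[S]_2 U); exact: mkE.
Qed.

Lemma GL2_inv g : [/\ ga g^-1%g = gd g / gD g, gb g^-1%g = - gb g / gD g,
  gc g^-1%g = - gc g / gD g & gd g^-1%g = ga g / gD g].
Proof.
have UD := gD_unit g.
have [|h [e1 e2 e3 e4]] := @GL2_exists (gd g / gD g) (- gb g / gD g) (- gc g / gD g) (ga g / gD g).
  have -> : gd g / gD g * (ga g / gD g) - - gb g / gD g * (- gc g / gD g) = (gD g)^-1 * (gD g)^-1 * gD g.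
    by rewrite {7}/gD; ring.
  by rewrite !unitrM !unitrV UD.
have -> : g^-1%g = h.
  apply/eqP; rewrite eq_invg_mul; apply/eqP.
  apply: GL2_eq; rewrite ?(gaM, gbM, gcM, gdM) ?e1 ?e2 ?e3 ?e4 ?ga1 ?gb1 ?gc1 ?gd1;
  by apply: (mulIr UD); rewrite mulrDl !mulrA !mulrVK // /gD; ring.
by [].
Qed.

(* [psi_A] only depends on the (1,2) entry, so this describes its conjugates. *)
Lemma gb_conj g k : gb (g * k * g^-1)%g =
  (ga g ^+ 2 * gb k + ga g * gb g * (gd k - ga k) - gb g ^+ 2 * gc k) / gD g.
Proof.
have [e1 e2 e3 e4] := GL2_inv g.
by rewrite gbM gaM gbM e2 e4; ring.
Qed.

Lemma psiAE (psi : S -> algC) (eps : S) g : psiA psi eps g = psi (eps * gb g).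
Proof.
rewrite /psiA; congr psi; rewrite /mxtrace sum_I2 !mulmx2E !mxE /=.
by rewrite /gb; ring.
Qed.

Lemma KsetP (pi : S) i g : reflect
  [/\ rdvdb (pi ^+ i) (ga g - 1), rdvdb (pi ^+ i) (gb g), rdvdb (pi ^+ i) (gc g)
    & rdvdb (pi ^+ i) (gd g - 1)] (g \in Kset pi i).
Proof.
have E : [/\ (GLval g - 1%:M : 'M_2) 0 0 = ga g - 1, (GLval g - 1%:M : 'M_2) 0 1 = gb g,
   (GLval g - 1%:M : 'M_2) 1 0 = gc g & (GLval g - 1%:M : 'M_2) 1 1 = gd g - 1].
  by rewrite !mxE /= !subr0.
case: E => e1 e2 e3 e4; rewrite inE; apply: (iffP forallP) => [h|[h1 h2 h3 h4]].
  by split; rewrite -?e1 -?e2 -?e3 -?e4; apply: (forallP (h _)).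
by apply: forall_I2; apply/forallP; apply: forall_I2; rewrite ?e1 ?e2 ?e3 ?e4.
Qed.

Lemma Kset_normal (G : {group {'GL_2[S]}}) (pi : S) i : (G :&: Kset pi i <| G)%g.
Proof.
apply/andP; split; first exact: subsetIl.
apply/subsetP=> g Gg; rewrite inE; apply/subsetP=> _ /imsetP[k /setIP[Gk Kk] ->].
rewrite in_setI groupJ //=; move: Kk; rewrite !inE => Kk.
apply/forallP=> a; apply/forallP=> b.
have -> : GLval (k ^ g) - 1%:M = invmx (GLval g) *m (GLval k - 1%:M) *m GLval g.
  rewrite mulmxBr mulmx1 mulmxBl mulVmx ?(GL_unitmx g) //.
  by rewrite conjgE mulgA !GL_MxE GL_VxE.
move: Kk; move: (GLval k - 1%:M) => X /forallP HX.
rewrite mxE; apply: (big_ind (rdvdb (pi ^+ i))) => [||c _]; [exact: rdvdb0| exact: rdvdbD|].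
apply: rdvdbMr; rewrite mxE; apply: (big_ind (rdvdb (pi ^+ i))) => [||e _]; [exact: rdvdb0| exact: rdvdbD|].
by apply: rdvdbMl; have /forallP := HX e; apply.
Qed.
End GL2.

(** With [f] a coset map, this bounds an index by the number of values of an invariant [F] that
    separates the cosets. *)
Lemma card_imset_factor (aT bT cT : finType) (A : {set aT}) (f : aT -> bT) (F : aT -> cT) :
  {in A &, forall x y, F x = F y -> f x = f y} -> (#|f @: A| <= #|F @: A|)%N.
Proof.
move=> ext; have [->|/set0Pn[x0 Ax0]] := eqVneq A set0; first by rewrite !imset0 cards0.
pose h v := f (odflt x0 [pick x in A | F x == v]).
apply: leq_trans (leq_imset_card h (F @: A)); apply/subset_leq_card/subsetP.
move=> _ /imsetP[x Ax ->]; apply/imsetP; exists (F x); first exact: imset_f.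
rewrite /h; case: pickP => [y /andP[Ay /eqP E]|/(_ x)]; last by rewrite Ax eqxx.
by apply: ext.
Qed.

(* [G] is a form of GL_2 over [R], with points in [S]: [R = S] and [eps = 1] for GL_2, [S = R[theta]] and [eps = theta] for GU_2. *)
Record GL2_form (R S : finComUnitRingType) (p : R) (l : nat) (io : {rmorphism R -> S})
    (eps : S) (eta : R) (G : {group {'GL_2[S]}}) : Prop := GL2Form {
  form_inj : injective io;
  form_ann : forall i (x : S), (i <= l)%N -> io p ^+ i * x = 0 ->
    exists y, x = io p ^+ (l - i) * y;
  form_eps : eps * eps = io eta;
  form_eta : eta \is a GRing.unit;
  form_unip : forall s, exists2 g, g \in G &
    [/\ ga g = 1, gb g = io s * eps, gc g = 0 & gd g = 1];
  form_diag : forall j z, (j <= l)%N -> z \is a GRing.unit -> p ^+ j * (z - 1) = 0 ->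
    exists2 g, g \in G &
    [/\ gb g = 0, gc g = 0, gd g = io z * ga g & io p ^+ j * (ga g - 1) = 0];
  form_row : forall g, g \in G -> exists m n,
    ga g * gb g = gD g * (eps * io m) /\ ga g * ga g = gD g * io n;
  form_ratio : forall g, g \in G -> ga g \is a GRing.unit -> exists t : R * R * R,
    [/\ gb g = ga g * (eps * io t.1.1), gc g = ga g * (eps * io t.1.2)
      & gd g = ga g * io t.2];
  form_scalar : forall j g h z, (j < l)%N -> g \in G -> h \in G -> z \is a GRing.unit ->
    [/\ io p ^+ j * (ga h - z * ga g) = 0, io p ^+ j * (gb h - z * gb g) = 0,
        io p ^+ j * (gc h - z * gc g) = 0 & io p ^+ j * (gd h - z * gd g) = 0] ->
    exists2 k, k \in G & [/\ gb k = 0, gc k = 0, gd k = ga k & io p ^+ j * (ga k - z) = 0]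
}.

(** * The multiplicity bound for a form of GL_2 *)

Section Form.
Variables (R S : finComUnitRingType) (p : R) (l q : nat) (io : {rmorphism R -> S}).
Variables (eps : S) (eta : R) (G : {group {'GL_2[S]}}) (psi : S -> algC).
Hypotheses (cR : chain_ring p l q) (l_ge2 : (2 <= l)%N).
Hypothesis formG : GL2_form p l io eps eta G.
Hypotheses (psi0 : psi 0 = 1) (psiD : forall x y, psi (x + y) = psi x * psi y).
Hypothesis psi_nontriv : exists x, psi (io (p ^+ l.-1 * x)) != 1.

Let P := io p.
Let l1 := l./2.
Let l2 := (l - l1)%N.
Let l1_gt0 : (0 < l1)%N. Proof. by rewrite /l1; lia. Qed.
Let l1_le : (l1 <= l2)%N. Proof. by rewrite /l2 /l1; lia. Qed.
Let l2_le : (l2 <= l1 + 1)%N. Proof. by rewrite /l2 /l1; lia. Qed.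
Let lE : (l = l1 + l2)%N. Proof. by rewrite /l2 /l1; lia. Qed.
Let l0 : (0 < l)%N. Proof. by lia. Qed.

(** * Valuations, and nondegeneracy of the additive character *)

Lemma P_nil : P ^+ l = 0.
Proof. by rewrite -rmorphXn (chain_nil cR) rmorph0. Qed.

Lemma P_ge k : (l <= k)%N -> P ^+ k = 0.
Proof. by move=> le; rewrite -(subnKC le) exprD P_nil mul0r. Qed.

Lemma P_mono i j x : (i <= j)%N -> P ^+ i * x = 0 -> P ^+ j * x = 0.
Proof. by move=> le E; rewrite -(subnK le) exprD -mulrA E mulr0. Qed.

(** Valuations add: x and y are divisible by P^(l - i) and P^(l - j). *)
Lemma P_mul i j k x y : (i <= l)%N -> (j <= l)%N -> (i + j <= l + k)%N ->
  P ^+ i * x = 0 -> P ^+ j * y = 0 -> P ^+ k * (x * y) = 0.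
Proof.
move=> il jl le /(form_ann formG il)[x' ->] /(form_ann formG jl)[y' ->].
have -> : P ^+ k * (io p ^+ (l - i) * x' * (io p ^+ (l - j) * y')) =
  P ^+ (k + (l - i) + (l - j)) * (x' * y') by rewrite /P !exprD; ring.
by rewrite P_ge ?mul0r //; lia.
Qed.

Lemma eps_unit : eps \is a GRing.unit.
Proof.
have := rmorph_unit io (form_eta formG); rewrite -(form_eps formG) unitrM.
by case/andP.
Qed.

Lemma psi_neq0 x : psi x != 0.
Proof.
have : psi x * psi (- x) = 1 by rewrite -psiD subrr.
by apply: contra_eq_neq => ->; rewrite mul0r eq_sym oner_eq0.
Qed.

(** Every nonzero ideal of R contains p^(l-1) R, where [psi] is nontrivial. *)
Lemma psi_ann (x : R) : (forall s, psi (io (x * s)) = 1) -> x = 0.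
Proof.
move=> trivx; have [k [u [Uu xE]]] := chain_fact cR x.
case: (leqP l k) => [lk|kl]; first by rewrite xE -(subnK lk) exprD (chain_nil cR) !mulr0.
have [y /eqP[]] := psi_nontriv; rewrite -(trivx (u^-1 * p ^+ (l.-1 - k) * y)).
congr (psi (io _)); rewrite xE -{1}(@subnK k l.-1); last by lia.
by rewrite exprD -[LHS](mulKr Uu); ring.
Qed.

Lemma psi_inj (x y : R) : (forall s, psi (io (x * s)) = psi (io (y * s))) -> x = y.
Proof.
move=> E; apply/eqP; rewrite -subr_eq0; apply/eqP/psi_ann => s.
apply: (mulIf (psi_neq0 (io (y * s)))).
by rewrite -psiD -rmorphD mul1r -E; congr (psi (io _)); ring.
Qed.

Lemma eta_inj (x y : R) : eta * x = eta * y -> x = y.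
Proof. exact/mulrI/(form_eta formG). Qed.

Lemma KsetE i g : (i <= l)%N -> reflect
  [/\ P ^+ (l - i) * (ga g - 1) = 0, P ^+ (l - i) * gb g = 0, P ^+ (l - i) * gc g = 0
    & P ^+ (l - i) * (gd g - 1) = 0] (g \in Kset P i).
Proof.
move=> il; have E x : reflect (P ^+ (l - i) * x = 0) (rdvdb (P ^+ i) x).
  apply: (iffP existsP) => [[y /eqP->]|].
    by rewrite mulrA -exprD subnK // P_nil mul0r.
  by move=> /(form_ann formG (leq_subr _ _))[y]; rewrite subKn // => ->; exists y.
by apply: (iffP (KsetP _ _ _)) => -[/E h1 /E h2 /E h3 /E h4].
Qed.

Let K : {group {'GL_2[S]}} := (G :&: Kset P l2)%G.
Let H : {group {'GL_2[S]}} := (G :&: Kset P l1)%G.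

Lemma K_normal : (K <| G)%g. Proof. exact: Kset_normal. Qed.

(** Congruence modulo P^l2 is tested by P^l1, since l - l2 = l1; for H the two exponents change
    places. *)
Lemma KP g : reflect
  [/\ g \in G, P ^+ l1 * (ga g - 1) = 0, P ^+ l1 * gb g = 0, P ^+ l1 * gc g = 0
    & P ^+ l1 * (gd g - 1) = 0] (g \in K).
Proof.
have l2l : (l2 <= l)%N by lia.
have e : (l - l2 = l1)%N by lia.
apply: (iffP setIP) => [[Gg /(KsetE _ l2l)]|[Gg h1 h2 h3 h4]]; first by rewrite e => -[].
by split=> //; apply/(KsetE _ l2l); rewrite e.
Qed.

Lemma HP g : reflect
  [/\ g \in G, P ^+ l2 * (ga g - 1) = 0, P ^+ l2 * gb g = 0, P ^+ l2 * gc g = 0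
    & P ^+ l2 * (gd g - 1) = 0] (g \in H).
Proof.
have l1l : (l1 <= l)%N by lia.
have e : (l - l1 = l2)%N by lia.
apply: (iffP setIP) => [[Gg /(KsetE _ l1l)]|[Gg h1 h2 h3 h4]]; first by rewrite e => -[].
by split=> //; apply/(KsetE _ l1l); rewrite e.
Qed.

(** A character of K of the form psi (u b + v (d - a) - w c), with a, b, c, d the entries, is probed
    by these elements for u and by those of [K_diag] for v. *)
Lemma K_unip s : exists2 k, k \in K &
  [/\ ga k = 1, gb k = io (p ^+ l2 * s) * eps, gc k = 0 & gd k = 1].
Proof.
have [k Gk [a b c d]] := form_unip formG (p ^+ l2 * s); exists k => //.
apply/KP; rewrite a b c d subrr mulr0 Gk; split=> //.
by rewrite rmorphM rmorphXn !mulrA -exprD P_ge ?mul0r //; lia.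
Qed.

Lemma K_diag s : exists2 k, k \in K &
  [/\ gb k = 0, gc k = 0 & gd k - ga k = io (p ^+ l2 * s)].
Proof.
have E1 : p ^+ l1 * (1 + p ^+ l2 * s - 1) = 0.
  by rewrite addrAC subrr add0r mulrA -exprD -lE (chain_nil cR) mul0r.
have l1l : (l1 < l)%N by lia.
have Uz := chain_unit_ann cR l1l E1.
have [k Gk [b c d a]] := form_diag formG (ltnW l1l) Uz E1.
(* The exact difference is p^l2 s times [ga k]; that factor disappears since [ga k] is 1 modulo p^l2
   and 2 l2 >= l. *)
have dE : gd k - ga k = io (p ^+ l2 * s).
  rewrite d rmorphD rmorph1 mulrDl mul1r addrAC subrr add0r.
  apply/eqP; rewrite -subr_eq0; apply/eqP.
  have -> : io (p ^+ l2 * s) * ga k - io (p ^+ l2 * s) =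
     io s * (P ^+ l2 * (ga k - 1)) by rewrite rmorphM rmorphXn /P; ring.
  by rewrite (P_mono l1_le a) mulr0.
exists k => //; apply/KP; split; rewrite ?Gk ?b ?c ?mulr0 //.
have -> : gd k - 1 = (ga k - 1) + io (p ^+ l2 * s) by rewrite -dE; ring.
by rewrite mulrDr a add0r rmorphM rmorphXn mulrA -exprD -lE P_nil mul0r.
Qed.

(** The upper right entry is additive on K: the error terms are products of two multiples of P^l2,
    and 2 l2 >= l. *)
Lemma lam_exists : exists j : Iirr K, {in K, forall k, 'chi_j k = psi (eps * gb k)}.
Proof.
pose r (k : {'GL_2[S]}) : 'M[algC]_1 := (psi (eps * gb k))%:M.
have rP : mx_repr K r.
  split=> [|x y /KP[_ xa xb xc xd] /KP[_ ya yb yc yd]]; first by rewrite /r gb1 mulr0 psi0.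
  rewrite /r -scalar_mxM -psiD -mulrDr; congr (psi (eps * _))%:M.
  have h1 : (ga x - 1) * gb y = 0.
    by rewrite -[LHS]mul1r -(expr0 P); apply: (@P_mul l1 l1) => //; lia.
  have h2 : gb x * (gd y - 1) = 0.
    by rewrite -[LHS]mul1r -(expr0 P); apply: (@P_mul l1 l1) => //; lia.
  rewrite gbM -[LHS]subr0 -h1 -[LHS]subr0 -h2; ring.
pose rK := MxRepresentation rP.
have Lr : cfRepr rK \is a linear_char.
  by rewrite qualifE /= cfRepr_char cfRepr1 eqxx.
have /irrP[j jE] := lin_char_irr Lr; exists j => k Kk.
by rewrite -jE cfunE Kk mulr1n /= /r mxtrace_scalar mulr1n.
Qed.

(** * Inertia group, orbit and multiplicities of psi_A *)

Section Lambda.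
Variable j : Iirr K.
Hypothesis jE : {in K, forall k, 'chi_j k = psi (eps * gb k)}.

Lemma res_containsE (i : Iirr G) :
  res_contains K 'chi_i (psiA psi eps) <-> lmult j i != 0.
Proof.
rewrite /res_contains /lmult cfdotE mulf_eq0 invr_eq0 pnatr_eq0 eqn0Ngt cardG_gt0 /=.
suff -> : \sum_(k in K) 'chi_i k * (psiA psi eps k)^*
    = \sum_(x in K) ('Res[K] 'chi_i) x * ('chi_j x)^* by [].
apply: eq_bigr => k Kk; rewrite jE // psiAE cfResE //.
exact: normal_sub K_normal.
Qed.

Lemma lam_conj g k : g \in G -> k \in K -> ('chi_j ^ g)%CF k =
  psi (eps * ((ga g ^+ 2 * gb k + ga g * gb g * (gd k - ga k) - gb g ^+ 2 * gc k) / gD g)).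
Proof.
move=> Gg Kk; have nKg := subsetP (normal_norm K_normal) g Gg.
rewrite cfConjgE // jE ?memJ_norm ?groupV // -gb_conj.
by rewrite conjgE invgK mulgA.
Qed.

(** Modulo p^l1 these elements centralise A. By [form_row] the coefficients of the conjugated
    character involve elements m and n of R, so testing on [K_diag] and [K_unip] with [psi_inj]
    forces m = 0 and n = 1 modulo p^l1; the determinant then gives the last diagonal entry. *)
Lemma inertiaE g : g \in 'I_G['chi_j]%g ->
  [/\ g \in G, ga g \is a GRing.unit, P ^+ l2 * gb g = 0 & P ^+ l2 * (gd g - ga g) = 0].
Proof.
move=> /setIP[Gg /inertiaJ invg].
have UD := gD_unit g; have [m [n [mE nE]]] := form_row formG Gg.
have inv k : k \in K ->
  psi (eps * ((ga g ^+ 2 * gb k + ga g * gb g * (gd k - ga k) - gb g ^+ 2 * gc k) / gD g))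
  = psi (eps * gb k) by move=> Kk; rewrite -lam_conj // invg jE.
have En : p ^+ l2 * (n - 1) = 0.
  rewrite mulrBr mulr1; apply/eqP; rewrite subr_eq0; apply/eqP/eta_inj/psi_inj => s.
  have [k Kk [a b c d]] := K_unip s; have := inv k Kk.
  rewrite a b c d => E; transitivity (psi (eps * (io (p ^+ l2 * s) * eps))); last first.
    by congr psi; rewrite !rmorphM -(form_eps formG); ring.
  rewrite -E; congr psi; rewrite expr2 nE !rmorphM -(form_eps formG).
  by apply: (mulIr UD); rewrite -!mulrA mulVr //; ring.
have Em : p ^+ l2 * m = 0.
  apply/eta_inj/psi_inj => s; have [k Kk [b c d]] := K_diag s; have := inv k Kk.
  rewrite b c d !mulr0 add0r subr0 mul0r rmorph0 => <-; congr psi.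
  rewrite mE !rmorphM -(form_eps formG).
  by apply: (mulIr UD); rewrite -!mulrA mulVr //; ring.
have Ua : ga g \is a GRing.unit.
  have Un : n \is a GRing.unit by apply: (chain_unit_ann cR _ En); lia.
  have : ga g * ga g \is a GRing.unit by rewrite nE unitrM UD rmorph_unit.
  by rewrite unitrM => /andP[].
have Eb : P ^+ l2 * gb g = 0.
  apply: (mulrI Ua); rewrite mulrCA mE mulr0.
  have -> : P ^+ l2 * (gD g * (eps * io m)) = gD g * eps * io (p ^+ l2 * m).
    by rewrite rmorphM rmorphXn; ring.
  by rewrite Em rmorph0 mulr0.
split=> //; apply: (mulrI Ua); rewrite mulr0.
have -> : ga g * (P ^+ l2 * (gd g - ga g)) = P ^+ l2 * (gD g - ga g * ga g) + gc g * (P ^+ l2 * gb g).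
  by rewrite /gD; ring.
rewrite Eb mulr0 addr0 nE.
have -> : P ^+ l2 * (gD g - gD g * io n) = - gD g * io (p ^+ l2 * (n - 1)).
  by rewrite rmorphM rmorphB rmorphXn rmorph1; ring.
by rewrite En rmorph0 mulr0.
Qed.

Lemma K_congr m h : m \in G -> h \in G ->
  [/\ P ^+ l1 * (ga h - ga m) = 0, P ^+ l1 * (gb h - gb m) = 0,
      P ^+ l1 * (gc h - gc m) = 0 & P ^+ l1 * (gd h - gd m) = 0] -> (m^-1 * h)%g \in K.
Proof.
move=> Gm Gh [ea eb ec ed]; have UD := gD_unit m.
have [i1 i2 i3 i4] := GL2_inv m.
have DV : gD m / gD m = 1 by rewrite divrr.
have aE : gd m / gD m * ga m + - gb m / gD m * gc m = 1 by rewrite -DV /gD; ring.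
have dE : - gc m / gD m * gb m + ga m / gD m * gd m = 1 by rewrite -DV /gD; ring.
apply/KP; rewrite groupM ?groupV // gaM gbM gcM gdM i1 i2 i3 i4; split=> //.
- rewrite -aE; transitivity (gd m / gD m * (P ^+ l1 * (ga h - ga m))
     - gb m / gD m * (P ^+ l1 * (gc h - gc m))); first by ring.
  by rewrite ea ec !mulr0 subr0.
- transitivity (gd m / gD m * (P ^+ l1 * (gb h - gb m))
     - gb m / gD m * (P ^+ l1 * (gd h - gd m))); first by ring.
  by rewrite eb ed !mulr0 subr0.
- transitivity (ga m / gD m * (P ^+ l1 * (gc h - gc m))
     - gc m / gD m * (P ^+ l1 * (ga h - ga m))); first by ring.
  by rewrite ea ec !mulr0 subr0.
rewrite -dE; transitivity (ga m / gD m * (P ^+ l1 * (gd h - gd m))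
   - gc m / gD m * (P ^+ l1 * (gb h - gb m))); first by ring.
by rewrite eb ed !mulr0 subr0.
Qed.

(** A coset of Z(G) K is determined by the ratios of the other entries to [ga g], taken modulo p^l2
    as multiples of p^l1. *)
Lemma inertia_index :
  (#|('I_G['chi_j]%g : {set {'GL_2[S]}}) : 'Z(G) <*> K|%g <= q ^ (3 * l2 - 2 * l1))%N.
Proof.
have [t tP] : exists t : {'GL_2[S]} -> R * R * R, forall g, g \in G -> ga g \is a GRing.unit ->
    [/\ gb g = ga g * (eps * io (t g).1.1), gc g = ga g * (eps * io (t g).1.2)
      & gd g = ga g * io (t g).2].
  apply: (fin_all_exists (P := fun g (t : R * R * R) => g \in G -> ga g \is a GRing.unit ->
    [/\ gb g = ga g * (eps * io t.1.1), gc g = ga g * (eps * io t.1.2)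
      & gd g = ga g * io t.2])) => g.
  have [Gg|nGg] := boolP (g \in G); last by exists (0, 0, 0).
  have [Ug|nUg] := boolP (ga g \is a GRing.unit); last by exists (0, 0, 0).
  by have [t tE] := form_ratio formG Gg Ug; exists t.
pose F g := (p ^+ l1 * (t g).1.1, p ^+ l1 * (t g).1.2, p ^+ l1 * ((t g).2 - 1)).
(* The lower left ratio is free, with q^l2 values; by [inertiaE] the other two are fixed modulo
   p^l1, leaving q^(l2 - l1) values each. *)
pose B := setX (setX (pideal p (2 * l1)) (pideal p l1)) (pideal p (2 * l1)).
have -> : (q ^ (3 * l2 - 2 * l1) = #|B|)%N.
  rewrite !cardsX !(chain_card cR) -?expnD; try lia.
  by congr (_ ^ _)%N; lia.
rewrite /indexg /rcosets.
apply: (leq_trans (card_imset_factor (F := F) _)); last first.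
  apply/subset_leq_card/subsetP=> _ /imsetP[g /inertiaE[Gg Ug Eb Ed] ->].
  have [bE cE dE] := tP g Gg Ug.
  have l2l : (l2 <= l)%N by lia.
  have l12 : (l - l2 = l1)%N by lia.
  have /(chain_ann cR l2l)[x xE] : p ^+ l2 * (t g).1.1 = 0.
    apply: (form_inj formG); apply: (mulrI (eps_unit)); apply: (mulrI Ug).
    by rewrite rmorph0 !mulr0 -Eb bE rmorphM rmorphXn -/P; ring.
  have /(chain_ann cR l2l)[y yE] : p ^+ l2 * ((t g).2 - 1) = 0.
    apply: (form_inj formG); apply: (mulrI Ug).
    by rewrite rmorph0 !mulr0 -Ed dE rmorphM rmorphXn rmorphB rmorph1 -/P; ring.
  rewrite !in_setX /=; apply/andP; split; [apply/andP; split|]; apply/pidealP.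
  - by exists x; rewrite xE l12 mulrA -exprD addnn mul2n.
  - by exists (t g).1.2.
  - by exists y; rewrite yE l12 mulrA -exprD addnn mul2n.
move=> g h /inertiaE[Gg Ug _ _] /inertiaE[Gh Uh _ _] [eb ec ed].
have [bg cg dg] := tP g Gg Ug; have [bh ch dh] := tP h Gh Uh.
have ioE x y : p ^+ l1 * x = p ^+ l1 * y -> P ^+ l1 * (io x - io y) = 0.
  by move=> E; rewrite mulrBr -!rmorphXn -!rmorphM E subrr.
have {}ed : p ^+ l1 * (t g).2 = p ^+ l1 * (t h).2.
  by move: ed; rewrite !mulrBr => /addIr.
(* Now h is z g modulo P^l2, but z need not be a scalar of G; [form_scalar] supplies a scalar of G
   congruent to it. *)
pose z := ga h / ga g.
have Uz : z \is a GRing.unit by rewrite unitrM Uh unitrV.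
have zE : z * ga g = ga h by rewrite /z mulrVK.
have zP : [/\ P ^+ l1 * (ga h - z * ga g) = 0, P ^+ l1 * (gb h - z * gb g) = 0,
        P ^+ l1 * (gc h - z * gc g) = 0 & P ^+ l1 * (gd h - z * gd g) = 0].
  rewrite bh ch dh bg cg dg !mulrA zE subrr mulr0; split=> //.
  - transitivity (- (ga h * eps) * (P ^+ l1 * (io (t g).1.1 - io (t h).1.1))); first by ring.
    by rewrite ioE // mulr0.
  - transitivity (- (ga h * eps) * (P ^+ l1 * (io (t g).1.2 - io (t h).1.2))); first by ring.
    by rewrite ioE // mulr0.
  - transitivity (- ga h * (P ^+ l1 * (io (t g).2 - io (t h).2))); first by ring.
    by rewrite ioE // mulr0.
have l1l : (l1 < l)%N by lia.
have [k Gk [kb kc kd kz]] := form_scalar formG l1l Gg Gh Uz zP.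
have Zk : k \in 'Z(G)%g.
  apply/centerP; split=> // x Gx; apply: GL2_eq;
  by rewrite ?(gaM, gbM, gcM, gdM) ?kb ?kc ?kd; ring.
have Kk : ((k * g)^-1 * h)%g \in K.
  case: zP => z1 z2 z3 z4; apply: K_congr; rewrite ?groupM //.
  have sh x y : P ^+ l1 * (x - z * y) = 0 -> P ^+ l1 * (x - ga k * y) = 0.
    move=> E; transitivity (P ^+ l1 * (x - z * y) - y * (P ^+ l1 * (ga k - z))); first by ring.
    by rewrite E kz mulr0 subr0.
  by rewrite !(gaM, gbM, gcM, gdM) kb kc kd !mul0r !addr0 !add0r; split; apply: sh.
rewrite !rcosetE; apply/rcoset_eqP; rewrite mem_rcoset.
rewrite -groupV invMg invgK.
have -> : (h * g^-1 = k * (((k * g)^-1 * h) ^ g^-1))%g.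
  by rewrite conjgE invgK invMg !mulgA mulgK mulgV mul1g.
rewrite groupM ?(subsetP (joing_subl _ _) _ Zk) ?(subsetP (joing_subr _ _)) //.
by rewrite memJ_norm ?(subsetP (normal_norm K_normal)) ?groupV.
Qed.

(** The conjugating element is upper triangular with ratio z^-1 on the diagonal: the coefficients of
    b and d - a become z and [eps] x. The coefficient of c contains x^2, and c is divisible by P^l2
    on K, so that term vanishes. *)
Lemma orbit_elt z x : z \is a GRing.unit -> p ^+ l2 * (x * x) = 0 ->
  exists2 g, g \in G & {in K, forall k, ('chi_j ^ g)%CF k =
    psi (eps * (io z * gb k + eps * io x * (gd k - ga k)))}.
Proof.
move=> Uz x2; have Uz' : z^-1 \is a GRing.unit by rewrite unitrV.
(* For exponent l the congruence is void, so every unit is allowed as diagonal ratio. *)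
have [|d Gd [db dc dd _]] := form_diag formG (leqnn l) Uz'.
  by rewrite (chain_nil cR) mul0r.
have [u Gu [ua ub uc ud]] := form_unip formG (x / z).
exists (d * u)%g; first exact: groupM.
move=> k Kk; rewrite lam_conj ?groupM //; congr (psi (eps * _)).
have UD := gD_unit (d * u)%g.
have /KP[_ _ _ kc _] := Kk.
have l1l : (l1 <= l)%N by lia.
have [y yE] := form_ann formG l1l kc.
have c0 : io x * io x * gc k = 0.
  rewrite yE (_ : l - l1 = l2)%N // -rmorphM -rmorphXn mulrA -rmorphM [_ * p ^+ l2]mulrC x2.
  by rewrite rmorph0 mul0r.
apply: (mulIr UD); rewrite mulrVK // /gD !(gaM, gbM, gcM, gdM) ua ub uc ud db dc dd.
rewrite !rmorphM; have zz : io z * io z^-1 = 1 by rewrite -rmorphM mulrV // rmorph1.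
set w := io z^-1 in zz *.
transitivity (ga d * ga d * ((io z * w) * gb k + (io x * w * eps) * (gd k - ga k))
   - (ga d * w * eps) ^+ 2 * (io x * io x * gc k)).
  by rewrite zz; ring.
by rewrite c0 mulr0 subr0; ring.
Qed.

(** * The commutator pairing *)

Lemma mulHH x y : P ^+ l2 * x = 0 -> P ^+ l2 * y = 0 -> P ^+ l1 * (x * y) = 0.
(* Both factors are divisible by P^l1, and 3 l1 >= l because l1 >= 1. *)
Proof. by apply: P_mul; lia. Qed.

Lemma mulHK x y : P ^+ l2 * x = 0 -> P ^+ l1 * y = 0 -> x * y = 0.
Proof. by move=> h1 h2; rewrite -[LHS]mul1r -(expr0 P); apply: (@P_mul l2 l1) => //; lia. Qed.

Lemma mulKH x y : P ^+ l1 * x = 0 -> P ^+ l2 * y = 0 -> x * y = 0.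
Proof. by move=> h1 h2; rewrite mulrC mulHK. Qed.

Lemma sub_KH : K \subset H.
Proof.
apply/subsetP=> k /KP[Gk a b c d].
by apply/HP; split=> //; apply: (P_mono l1_le).
Qed.

Lemma sub_HG : H \subset G. Proof. exact: subsetIl. Qed.

Lemma cent_HK : H \subset 'C(K)%g.
Proof.
apply/subsetP=> h /HP[_ ha hb hc hd]; apply/centP=> k /KP[_ ka kb kc kd].
apply: GL2_eq; rewrite ?(gaM, gbM, gcM, gdM).
- by rewrite (mulHK hb kc) (mulKH kb hc); ring.
- have := mulHK ha kb; have := mulKH kb hd; have := mulHK hb kd; have := mulKH ka hb.
  move=> e1 e2 e3 e4; apply/eqP; rewrite -subr_eq0; apply/eqP.
  transitivity ((ga h - 1) * gb k - gb k * (gd h - 1) + gb h * (gd k - 1) - (ga k - 1) * gb h); first by ring.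
  by rewrite e1 e2 e3 e4; ring.
- have := mulHK hd kc; have := mulKH kc ha; have := mulHK hc ka; have := mulKH kd hc.
  move=> e1 e2 e3 e4; apply/eqP; rewrite -subr_eq0; apply/eqP.
  transitivity ((gd h - 1) * gc k - gc k * (ga h - 1) + gc h * (ga k - 1) - (gd k - 1) * gc h); first by ring.
  by rewrite e1 e2 e3 e4; ring.
by rewrite (mulHK hc kb) (mulKH kc hb); ring.
Qed.

Lemma commutator_HH : {in H &, forall h x, [~ h, x]%g \in K}.
Proof.
move=> h x Hh Hx; have /HP[Gh ha hb hc hd] := Hh; have /HP[Gx xa xb xc xd] := Hx.
have -> : ([~ h, x] = (x * h)^-1 * (h * x))%g by rewrite invMg commgEl conjgE !mulgA.
apply: K_congr; rewrite ?groupM // !(gaM, gbM, gcM, gdM); split.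
- transitivity (P ^+ l1 * (gb h * gc x) - P ^+ l1 * (gb x * gc h)); first by ring.
  by rewrite !mulHH ?subrr.
- transitivity (P ^+ l1 * ((ga h - 1) * gb x) - P ^+ l1 * (gb x * (gd h - 1))
     + P ^+ l1 * (gb h * (gd x - 1)) - P ^+ l1 * ((ga x - 1) * gb h)); first by ring.
  by rewrite !mulHH //; ring.
- transitivity (P ^+ l1 * ((gd h - 1) * gc x) - P ^+ l1 * (gc x * (ga h - 1))
     + P ^+ l1 * (gc h * (ga x - 1)) - P ^+ l1 * ((gd x - 1) * gc h)); first by ring.
  by rewrite !mulHH //; ring.
transitivity (P ^+ l1 * (gc h * gb x) - P ^+ l1 * (gc x * gb h)); first by ring.
by rewrite !mulHH ?subrr.
Qed.

(** Compare upper right entries in h x = (x h) [h, x]: the error terms are products of an H-term and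
    a K-term, which vanish as l1 + l2 = l. *)
Lemma lam_commutator h x : h \in H -> x \in H -> 'chi_j [~ h, x]%g =
  psi (eps * (gb x * (ga h - gd h) + gb h * (gd x - ga x))).
Proof.
move=> Hh Hx; have Kk := commutator_HH Hh Hx; rewrite jE //.
have /HP[_ ma mb _ _] := groupM Hx Hh; have /KP[_ ka kb kc kd] := Kk.
have := congr1 (@gb _) (mulKVg (x * h)%g (h * x)%g).
rewrite (_ : (x * h)^-1 * (h * x) = [~ h, x])%g; last first.
  by rewrite invMg commgEl conjgE !mulgA.
rewrite gbM => E; congr (psi (eps * _)).
have e1 := mulHK ma kb; have e2 := mulHK mb kd.
transitivity (ga (x * h)%g * gb [~ h, x]%g + gb (x * h)%g * gd [~ h, x]%g
   - gb (x * h)%g - (ga (x * h)%g - 1) * gb [~ h, x]%g - gb (x * h)%g * (gd [~ h, x]%g - 1)).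
  by ring.
by rewrite e1 e2 E !gbM; ring.
Qed.

Lemma H_unip s : exists2 h, h \in H &
  [/\ ga h = 1, gb h = io (p ^+ l1 * s) * eps, gc h = 0 & gd h = 1].
Proof.
have [h Gh [a b c d]] := form_unip formG (p ^+ l1 * s); exists h => //.
apply/HP; rewrite a b c d subrr mulr0 Gh; split=> //.
by rewrite rmorphM rmorphXn !mulrA -exprD P_ge ?mul0r //; lia.
Qed.

Lemma H_diag s : exists2 h, h \in H &
  [/\ gb h = 0, gc h = 0 & gd h - ga h = io (p ^+ l1 * s) * ga h].
Proof.
have E1 : p ^+ l2 * (1 + p ^+ l1 * s - 1) = 0.
  by rewrite addrAC subrr add0r mulrA -exprD addnC -lE (chain_nil cR) mul0r.
have l2l : (l2 < l)%N by lia.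
have Uz := chain_unit_ann cR l2l E1.
have [h Gh [b c d a]] := form_diag formG (ltnW l2l) Uz E1.
have dE : gd h - ga h = io (p ^+ l1 * s) * ga h.
  by rewrite d rmorphD rmorph1; ring.
exists h => //; apply/HP; split; rewrite ?Gh ?b ?c ?mulr0 //.
have -> : gd h - 1 = (ga h - 1) + io (p ^+ l1 * s) * ga h by rewrite -dE; ring.
by rewrite mulrDr a add0r rmorphM rmorphXn !mulrA -exprD addnC -lE P_nil !mul0r.
Qed.

(** By [rad_separated] this contains the radical of the pairing. The lower left entry is
    unconstrained because it does not occur in [lam_commutator]. *)
Let rad : {set {'GL_2[S]}} :=
  [set h in H | (P ^+ l1 * gb h == 0) && (P ^+ l1 * (gd h - ga h) == 0)].

Lemma rad_separated : {in H, forall h, h \notin rad ->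
  exists2 x, x \in H & 'chi_j [~ h, x]%g != 1}.
Proof.
move=> h Hh nrad; apply/exists_inP; apply: contraR nrad => /exists_inPn triv.
have {}triv x : x \in H -> psi (eps * (gb x * (ga h - gd h) + gb h * (gd x - ga x))) = 1.
  by move=> Hx; rewrite -lam_commutator //; apply/eqP; rewrite -[_ == _]negbK triv.
have /HP[Gh ha hb hc hd] := Hh.
have Ua : ga h \is a GRing.unit.
  have /inertiaE[] // : h \in 'I_G['chi_j]%g.
  by rewrite inE Gh (subsetP (cent_sub_inertia _)) // (subsetP cent_HK).
have [[[be ce] de] /= [bE cE dE]] := form_ratio formG Gh Ua.
have hbe : P ^+ l2 * io be = 0.
  apply: (mulrI eps_unit); apply: (mulrI Ua); rewrite !mulr0 -hb bE; ring.
have hde : P ^+ l2 * (io de - 1) = 0.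
  apply: (mulrI Ua); rewrite mulr0.
  transitivity (P ^+ l2 * (gd h - 1) - P ^+ l2 * (ga h - 1)); first by rewrite dE; ring.
  by rewrite hd ha subrr.
rewrite inE Hh /=; apply/andP; split; apply/eqP.
  suff p0 : p ^+ l1 * be = 0.
    transitivity (ga h * eps * io (p ^+ l1 * be)); first by rewrite bE rmorphM rmorphXn -/P; ring.
    by rewrite p0 rmorph0 mulr0.
  (* Pairing h with diagonal elements detects its upper right ratio [be]; pairing with unipotent
     ones, below, detects [1 - de]. *)
  apply: eta_inj; rewrite mulr0; apply: psi_ann => s.
  have [x Hx [xb xc xd]] := H_diag s; have /HP[_ xa _ _ _] := Hx.
  rewrite -(triv x Hx) xb xd; congr psi; rewrite !rmorphM rmorphXn -/P -(form_eps formG) bE.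
  have e1 := mulHH ha hbe; have e2 := mulHH xa hbe.
  transitivity (eps * eps * io s * (P ^+ l1 * io be + ga x * (P ^+ l1 * ((ga h - 1) * io be))
     + P ^+ l1 * ((ga x - 1) * io be))); last by ring.
  by rewrite e1 e2; ring.
suff p0 : p ^+ l1 * (1 - de) = 0.
  transitivity (- ga h * io (p ^+ l1 * (1 - de))).
    by rewrite dE rmorphM rmorphB rmorph1 rmorphXn -/P; ring.
  by rewrite p0 rmorph0 mulr0.
apply: eta_inj; rewrite mulr0; apply: psi_ann => s.
have [x Hx [xa xb xc xd]] := H_unip s.
rewrite -(triv x Hx) xb xd xa; congr psi.
rewrite !rmorphM rmorphB rmorph1 rmorphXn -/P -(form_eps formG) dE.
have e1 := mulHH ha hde.
transitivity (eps * eps * io s * (P ^+ l1 * (1 - io de) - P ^+ l1 * ((ga h - 1) * (io de - 1)))); last by ring.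
by rewrite e1; ring.
Qed.

(** On H, the values P^l1 b and P^l1 (d - a) add under multiplication and vanish exactly on [rad].
    Products of [H_unip] and [H_diag] elements realise every pair ([eps] y, w) with y, w in p^(2 l1)
    R, so translating [rad] by them gives disjoint sets. *)
Lemma card_rad : (#|rad| * q ^ (2 * (l2 - l1)) <= #|H|)%N.
Proof.
pose B := pideal p (2 * l1).
have cB : #|B| = (q ^ (l2 - l1))%N by rewrite (chain_card cR); [congr (_ ^ _)%N; lia|lia].
have -> : (q ^ (2 * (l2 - l1)) = #|setX B B|)%N by rewrite cardsX cB -expnD addnn mul2n.
rewrite -cardsX.
have [t tP] : exists t : R * R -> {'GL_2[S]}, forall yw, yw.1 \in B -> yw.2 \in B ->
    [/\ t yw \in H, P ^+ l1 * gb (t yw) = eps * io yw.1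
      & P ^+ l1 * (gd (t yw) - ga (t yw)) = io yw.2].
  apply: (fin_all_exists (P := fun (yw : R * R) (t : {'GL_2[S]}) => yw.1 \in B -> yw.2 \in B ->
    [/\ t \in H, P ^+ l1 * gb t = eps * io yw.1
      & P ^+ l1 * (gd t - ga t) = io yw.2])) => -[y w] /=.
  have [/pidealP[s yE]|nB] := boolP (y \in B); last by exists 1%g.
  have [/pidealP[r wE]|nB] := boolP (w \in B); last by exists 1%g.
  have [u Hu [ua ub uc ud]] := H_unip s; have [d Hd [db dc dd]] := H_diag r.
  exists (u * d)%g => _ _; have /HP[_ da _ _ dd'] := Hd.
  have P2 x : P ^+ l2 * x = 0 -> P ^+ (2 * l1) * x = 0.
    by apply: P_mono; lia.
  have PP : P ^+ (2 * l1) = P ^+ l1 * P ^+ l1 by rewrite -exprD addnn mul2n.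
  rewrite groupM // !(gaM, gbM, gcM, gdM) ua ub uc ud db dc; split=> //.
    transitivity (eps * io s * (P ^+ (2 * l1) + P ^+ (2 * l1) * (gd d - 1))).
      by rewrite PP rmorphM rmorphXn -/P; ring.
    by rewrite P2 // addr0 yE rmorphM rmorphXn -/P; ring.
  transitivity (P ^+ l1 * (gd d - ga d)); first by ring.
  rewrite dd; transitivity (io r * (P ^+ (2 * l1) + P ^+ (2 * l1) * (ga d - 1))).
    by rewrite PP rmorphM rmorphXn -/P; ring.
  by rewrite P2 // addr0 wE rmorphM rmorphXn -/P; ring.
pose f (x : {'GL_2[S]} * (R * R)) := (x.1 * t x.2)%g.
have fP x : x \in setX rad (setX B B) -> [/\ f x \in H, P ^+ l1 * gb (f x) = eps * io x.2.1
    & P ^+ l1 * (gd (f x) - ga (f x)) = io x.2.2].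
  case: x => h [y w] /setXP[/=]; rewrite inE => /andP[Hh /andP[/eqP h1 /eqP h2]] /setXP[yB wB].
  have [Ht /= t1 t2] := tP (y, w) yB wB; rewrite /f /=; move: (t (y, w)) Ht t1 t2 => u Hu u1 u2.
  have /HP[_ ha hb hc hd] := Hh; have /HP[_ ua ub uc ud] := Hu.
  rewrite groupM // !(gaM, gbM, gcM, gdM); split=> //.
    transitivity (P ^+ l1 * gb u + P ^+ l1 * ((ga h - 1) * gb u) + gd u * (P ^+ l1 * gb h)).
      by ring.
    by rewrite u1 h1 mulHH //; ring.
  transitivity (P ^+ l1 * (gd u - ga u) + P ^+ l1 * (gd h - ga h)
     + P ^+ l1 * ((gd h - 1) * (gd u - 1)) - P ^+ l1 * ((ga h - 1) * (ga u - 1))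
     + P ^+ l1 * (gc h * gb u) - P ^+ l1 * (gb h * gc u)); first by ring.
  by rewrite u2 h2 !mulHH //; ring.
rewrite -(card_in_imset (f := f)).
  by apply/subset_leq_card/subsetP=> _ /imsetP[x /fP[Hx _ _] ->].
move=> x y /fP[_ x1 x2] /fP[_ y1 y2] E.
have e1 : x.2.1 = y.2.1 by apply/(form_inj formG)/(mulrI eps_unit); rewrite -x1 -y1 E.
have e2 : x.2.2 = y.2.2 by apply: (form_inj formG); rewrite -x2 -y2 E.
have e : x.2 = y.2 by move: e1 e2; case: (x.2) => ? ?; case: (y.2) => ? ? /= -> ->.
move: E; rewrite /f e => /mulIg e'.
by move: e' e {e1 e2 x1 x2 y1 y2}; case: x => ? ?; case: y => ? ? /= -> ->.
Qed.

Lemma lmult_ge (i : Iirr G) : lmult j i != 0 -> (q ^ (l2 - l1))%:R <= lmult j i.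
Proof.
move=> nz.
have := @lmult_lower_bound _ G K j H rad i sub_KH sub_HG cent_HK commutator_HH rad_separated nz.
move=> le1; have le0 : 0 <= lmult j i by rewrite natr_ge0 ?lmult_nat.
rewrite -(@ler_pXn2r _ 2) ?nnegrE ?ler0n //.
have rad0 : 0 < #|rad|%:R :> algC.
  rewrite ltr0n; apply/card_gt0P; exists 1%g.
  by rewrite inE group1 /= gb1 gd1 ga1 subrr mulr0 eqxx.
rewrite -(ler_pM2l rad0) (le_trans _ le1) // -natrX -natrM ler_nat -expnM mulnC.
by rewrite (leq_trans _ card_rad) // mulnC [(_ * 2)%N]mulnC.
Qed.

(** The parameters x and z of the decompositions, multiplied by p^l2: the characters depend only on
    their classes modulo p^l1. In [W], the two removed sets are those where z, respectively 1 - z,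
    is not a unit. *)
Let Y : {set R} := pideal p (l2 + (l1 - l1./2)).
Let W : {set R} := pideal p l2 :\:
  (pideal p l2.+1 :|: [set p ^+ l2 + x | x in pideal p l2.+1]).

Lemma card_YW : ((q - 2) * q ^ (l1.-1 + l1./2) <= #|setX Y W|)%N.
Proof.
rewrite cardsX (chain_card cR); last by lia.
have -> : (l - (l2 + (l1 - l1./2)) = l1./2)%N by lia.
rewrite expnD mulnA mulnC leq_mul2l; apply/orP; right.
have q2 : (2 < q)%N by case/andP: (chain_q cR).
pose U := pideal p l2.+1; pose V := [set p ^+ l2 + x | x in U].
have cU : #|U| = (q ^ l1.-1)%N.
  by rewrite (chain_card cR); [congr (_ ^ _)%N; lia|lia].
have cV : #|V| = (q ^ l1.-1)%N by rewrite card_imset ?cU //; apply: addrI.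
have cA : #|pideal p l2| = (q * q ^ l1.-1)%N.
  by rewrite (chain_card cR) -?expnS; [congr (_ ^ _)%N; lia|lia].
rewrite /W -/U -/V cardsD cA.
have : (#|pideal p l2 :&: (U :|: V)| <= q ^ l1.-1 + q ^ l1.-1)%N.
  rewrite (leq_trans (subset_leq_card (subsetIr _ _))) //.
  by rewrite -{1}cU -cV cardsU leq_subr.
by rewrite mulnBl; lia.
Qed.

Lemma orbit_pair y w : (y, w) \in setX Y W -> exists xi : 'CF(K) * 'CF(K),
  [/\ xi.1 \in cfclass 'chi_j G, xi.2 \in cfclass 'chi_j G, xi.1 * xi.2 = 'chi_j
    & exists z x, [/\ w = p ^+ l2 * z, y = p ^+ l2 * x & {in K, forall k,
      xi.1 k = psi (eps * (io z * gb k + eps * io x * (gd k - ga k)))}]].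
Proof.
move=> /setXP[/= /pidealP[x' yE] /setDP[/pidealP[z wE]]].
rewrite inE negb_or => /andP[w1 w2].
pose x := p ^+ (l1 - l1./2) * x'.
have x2 : p ^+ l2 * (x * x) = 0.
  have -> : p ^+ l2 * (x * x) = p ^+ (l2 + (l1 - l1./2) + (l1 - l1./2)) * (x' * x').
    by rewrite /x !exprD; ring.
  have le : (l <= l2 + (l1 - l1./2) + (l1 - l1./2))%N by lia.
  by rewrite -(subnKC le) exprD (chain_nil cR) !mul0r.
have Uz : z \is a GRing.unit.
  case: (chain_unitVp cR z) => // -[v vE]; case/negP: w1; apply/pidealP.
  by exists v; rewrite wE vE exprSr mulrA.
have U1z : 1 - z \is a GRing.unit.
  case: (chain_unitVp cR (1 - z)) => // -[v vE]; case/negP: w2; apply/imsetP.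
  exists (p ^+ l2.+1 * - v); first by apply/pidealP; exists (- v).
  rewrite wE exprSr -[z in LHS](subKr 1) vE; ring.
have [g Gg gE] := orbit_elt Uz x2.
(* The complementary summand A - X has parameters 1 - z and -x. *)
have [|h Gh hE] := orbit_elt (x := - x) U1z; first by rewrite mulrNN.
exists (('chi_j ^ g)%CF, ('chi_j ^ h)%CF); split=> /=.
- by apply/cfclassP; exists g.
- by apply/cfclassP; exists h.
- apply/cfun_inP=> k Kk; rewrite cfunE gE // hE // -psiD jE //; congr psi.
  by rewrite rmorphB rmorph1 rmorphN; ring.
by exists z, x; split=> //; rewrite yE /x exprD mulrA.
Qed.

Lemma tensor_bound (i1 i2 : Iirr G) : lmult j i1 != 0 -> lmult j i2 != 0 ->
  exists2 i, lmult j i != 0 & (q%:R - 2) * (q%:R : algC) ^ ((l1./2 + l1)%N%:Z - l2%:Z - 1)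
        <= '['chi_i1 * 'chi_i2, 'chi_i].
Proof.
move=> nz1 nz2.
have q2 : (2 < q)%N by case/andP: (chain_q cR).
have q0 : (q%:R : algC) != 0 by rewrite pnatr_eq0; lia.
pose Om := setX Y W.
have Om0 : (0 < #|Om|)%N by apply: leq_trans card_YW; rewrite muln_gt0 expn_gt0; lia.
pose good (yw : R * R) (xi : 'CF(K) * 'CF(K)) := yw \in Om ->
  [/\ xi.1 \in cfclass 'chi_j G, xi.2 \in cfclass 'chi_j G, xi.1 * xi.2 = 'chi_j
    & exists z x, [/\ yw.2 = p ^+ l2 * z, yw.1 = p ^+ l2 * x & {in K, forall k,
      xi.1 k = psi (eps * (io z * gb k + eps * io x * (gd k - ga k)))}]].
have [xi xiP] : exists xi : R * R -> 'CF(K) * 'CF(K), forall yw, good yw (xi yw).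
  apply: (fin_all_exists (P := good)) => -[y w].
  have [YWin|nin] := boolP ((y, w) \in Om); last by exists (0, 0) => h; case/negP: nin.
  by have [xi h] := orbit_pair YWin; exists xi.
have [||i nzi le] := @tensor_multiplicity _ G K j K_normal _ Om
   (fun yw => (xi yw).1) (fun yw => (xi yw).2) i1 i2 nz1 nz2 Om0.
(* The character determines its parameters: diagonal elements of K recover y, unipotent ones recover
   w. *)
- move=> [y w] [y' w'] /xiP[_ _ _ [z [x [/= wE yE vE]]]] /xiP[_ _ _ [z' [x' [/= wE' yE' vE']]]] E.
  congr (_, _).
    rewrite yE yE'; apply: eta_inj; apply: psi_inj => s.
    have [k Kk [kb kc kd]] := K_diag s.
    have := vE k Kk; rewrite E vE' // kb kd !mulr0 !add0r => E2.
    rewrite (_ : io _ = eps * (eps * io x * io (p ^+ l2 * s))) -?E2; last first.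
      by rewrite !rmorphM -(form_eps formG); ring.
    by congr psi; rewrite !rmorphM -(form_eps formG); ring.
  rewrite wE wE'; apply: eta_inj; apply: psi_inj => s.
  have [k Kk [ka kb kc kd]] := K_unip s.
  have := vE k Kk; rewrite E vE' // kb kd ka subrr !mulr0 !addr0 => E2.
  rewrite (_ : io _ = eps * (io z * (io (p ^+ l2 * s) * eps))) -?E2; last first.
    by rewrite !rmorphM -(form_eps formG); ring.
  by congr psi; rewrite !rmorphM -(form_eps formG); ring.
- by move=> yw /xiP[].
exists i => //.
set m := '[_, _] in le *.
have m0 : 0 <= m by rewrite natr_ge0 // Cnat_cfdot_char_irr // rpredM ?irr_char.
(* Multiplying by the bound for the index clears the possibly negative exponent of q. *)
pose A := (q%:R : algC) ^+ (3 * l2 - 2 * l1).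
have A0 : 0 < A by rewrite exprn_gt0 // ltr0n; lia.
rewrite -(ler_pM2r A0).
apply: (@le_trans _ _ (m * #|('I_G['chi_j]%g : {set {'GL_2[S]}}) : 'Z(G) <*> K|%g%:R)); last first.
  by rewrite ler_wpM2l // /A -natrX ler_nat inertia_index.
apply: le_trans le.
have -> : (q%:R - 2) * (q%:R : algC) ^ ((l1./2 + l1)%N%:Z - l2%:Z - 1) * A
   = (q ^ (l2 - l1))%:R * (q ^ (l2 - l1))%:R * ((q - 2) * q ^ (l1.-1 + l1./2))%N%:R.
  rewrite /A -[_ ^+ (_ - _)]/(q%:R ^ Posz _) -mulrA -expfzDr //.
  rewrite natrM mulrCA natrB 1?ltnW // -natrM -expnD -natrM -expnD natrX.
  congr (_ * _); rewrite -[RHS]/(q%:R ^ Posz _); congr (_ ^ _).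
  move: (l1) (l2) l1_gt0 l1_le l2_le => a b; lia.
rewrite !ler_pM ?mulr_ge0 ?ler0n ?lmult_ge // ler_nat; exact: card_YW.
Qed.

End Lambda.

Lemma GL2_form_tensor : thm92_concl G P l eps psi q.
Proof.
move=> i1 i2; have [j jE] := lam_exists.
move=> /(res_containsE jE) nz1 /(res_containsE jE) nz2.
have [i nz le] := tensor_bound jE nz1 nz2.
by exists i; split=> //; apply/(res_containsE jE).
Qed.
End Form.

(** * GL_2 and GU_2 *)

Lemma GL2_form_GL (R : finComUnitRingType) (p : R) (l q : nat) :
  chain_ring p l q -> GL2_form p l (idfun : {rmorphism R -> R}) 1 1 'GL_2[R]%G.
Proof.
move=> cR; split=> //=.
- exact: chain_ann cR.
- by rewrite mulr1.
- by rewrite unitr1.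
- move=> s; have [|g gE] := @GL2_exists R 1 (s * 1) 0 1; last by exists g; rewrite ?inE.
  by rewrite mulr1 mulr0 subr0 unitr1.
- move=> j z _ Uz _; have [|g [ha hb hc hd]] := @GL2_exists R 1 0 0 z.
    by rewrite mul1r mul0r subr0.
  by exists g; rewrite ?inE // ha hb hc hd mulr1 subrr mulr0.
- move=> g _; exists (ga g * gb g / gD g), (ga g * ga g / gD g).
  by rewrite mul1r ![gD g * _]mulrC !mulrVK ?gD_unit.
- move=> g _ Ua; exists (gb g / ga g, gc g / ga g, gd g / ga g).
  by rewrite /= !mul1r ![ga g * _]mulrC !mulrVK.
- move=> j g h z _ _ _ Uz _; have [|k [ha hb hc hd]] := @GL2_exists R z 0 0 z.
    by rewrite mul0r subr0 unitrM Uz.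
  by exists k; rewrite ?inE // ha hb hc hd subrr mulr0.
Qed.

Section Unitary.
Variables (R : finComUnitRingType) (d : R).
Local Notation S := (quad d).
Local Notation conj := (@qconj R d).

Fact qemb_zmod : zmod_morphism (qemb d).
Proof. by move=> a b; apply: injective_projections => /=; rewrite ?subr0. Qed.
HB.instance Definition _ := GRing.isZmodMorphism.Build R S (qemb d) qemb_zmod.
Fact qemb_monoid : monoid_morphism (qemb d).
Proof. by split=> // a b; apply: injective_projections; rewrite /= /qmul /=; ring. Qed.
HB.instance Definition _ := GRing.isMonoidMorphism.Build R S (qemb d) qemb_monoid.

Lemma qembM (a : R) (x : S) : qemb d a * x = (a * x.1, a * x.2).
Proof. by apply: injective_projections; rewrite /= /qmul /=; ring. Qed.

Lemma qconj_emb a : conj (qemb d a) = qemb d a.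
Proof. by apply: injective_projections; rewrite /= ?oppr0. Qed.

Lemma qconjK : involutive conj.
Proof. by move=> x; apply: injective_projections; rewrite /= ?opprK. Qed.

Lemma qconj_theta : conj (qtheta d) = - qtheta d.
Proof. by apply: injective_projections; rewrite /= ?oppr0. Qed.

Lemma qtheta_sqr : qtheta d * qtheta d = qemb d d.
Proof. by apply: injective_projections; rewrite /= /qmul /=; ring. Qed.

Lemma qnormE (x : S) : conj x * x = qemb d (x.1 ^+ 2 - d * x.2 ^+ 2).
Proof. by apply: injective_projections; rewrite /= /qmul /=; ring. Qed.

(** Unitarity as [star g = g^-1], with the inverse given by cofactors; conjugation by W exchanges
    the diagonal entries. *)
Lemma GUP (g : {'GL_2[S]}) : reflect
  [/\ conj (ga g) = ga g / gD g, conj (gb g) = - gb g / gD g,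
      conj (gc g) = - gc g / gD g & conj (gd g) = gd g / gD g] (g \in GUgroup conj).
Proof.
have WV : invmx (Wmx S) = Wmx S.
  by rewrite -[LHS]mul1mx -(WmxK S) mulmxK // Wmx_unit.
have W00 : Wmx S 0 0 = 0 by rewrite mxE.
have W01 : Wmx S 0 1 = 1 by rewrite mxE.
have W10 : Wmx S 1 0 = 1 by rewrite mxE.
have W11 : Wmx S 1 1 = 0 by rewrite mxE.
pose A : 'M[S]_2 := GLval g.
have sE : [/\ star conj A 0 0 = conj (gd g), star conj A 0 1 = conj (gb g),
    star conj A 1 0 = conj (gc g) & star conj A 1 1 = conj (ga g)].
  rewrite /star WV !mulmx2E W00 W01 W10 W11 ![_^T _ _]mxE ![map_mx _ _ _ _]mxE.
  by split; rewrite !(mul0r, mul1r, mulr0, mulr1, addr0, add0r).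
case: sE => s00 s01 s10 s11.
have [i1 i2 i3 i4] := GL2_inv g.
have -> : (g \in GUgroup conj) = (star conj A == GLval g^-1%g).
  rewrite inE GL_VxE; apply/eqP/eqP => [E|->]; last by rewrite mulVmx // (GL_unitmx g).
  by rewrite -[RHS]mul1mx -E mulmxK // (GL_unitmx g).
apply: (iffP eqP) => [E|[h1 h2 h3 h4]].
  by rewrite -s00 -s01 -s10 -s11 E -i1 -i2 -i3 -i4.
apply/matrixP; apply: forall_I2; apply: forall_I2; rewrite ?s00 ?s01 ?s10 ?s11 ?h1 ?h2 ?h3 ?h4.
- exact: esym i1.
- exact: esym i2.
- exact: esym i3.
- exact: esym i4.
Qed.

Hypothesis U2 : (2%:R : R) \is a GRing.unit.

Lemma eq_opp0 (a : R) : a = - a -> a = 0.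
Proof.
by move=> E; apply: (mulrI U2); rewrite mulr0 mulr_natl mulr2n {1}E addNr.
Qed.

Lemma qconj_fix (x : S) : conj x = x -> x = qemb d x.1.
Proof.
move=> /(congr1 snd) /= E; apply: injective_projections => //=.
by apply: eq_opp0; rewrite E.
Qed.

Lemma qconj_anti (x : S) : conj x = - x -> x = qtheta d * qemb d x.2.
Proof.
move=> /(congr1 fst) /= /eq_opp0 E.
by apply: injective_projections; rewrite /= /qmul /= ?E; ring.
Qed.

Variables (p : R) (l q : nat).
Hypotheses (cR : chain_ring p l q) (l0 : (0 < l)%N) (Ud : d \is a GRing.unit).

Lemma qemb_unit (a : R) : a \is a GRing.unit -> qemb d a \is a GRing.unit.
Proof. exact: rmorph_unit. Qed.

(** A diagonal matrix with entries a, z a is unitary exactly when z times the norm of a is 1. *)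
Lemma GU_diag (a : S) (z : R) : z \is a GRing.unit -> conj a * a = qemb d z^-1 ->
  exists2 g, g \in GUgroup conj & [/\ ga g = a, gb g = 0, gc g = 0 & gd g = qemb d z * a].
Proof.
move=> Uz N; have Ua : a \is a GRing.unit.
  have : conj a * a \is a GRing.unit by rewrite N qemb_unit ?unitrV.
  by rewrite unitrM => /andP[].
have UD : a * (qemb d z * a) \is a GRing.unit by rewrite !unitrM Ua qemb_unit.
have NE : conj a * a * qemb d z = 1 by rewrite N -rmorphM mulVr // rmorph1.
have [|g [ha hb hc hd]] := @GL2_exists _ a 0 0 (qemb d z * a).
  by rewrite mul0r subr0.
exists g => //; apply/GUP.
rewrite /gD ha hb hc hd !rmorph0 !oppr0 !mul0r subr0; split=> //.
  apply: (mulIr UD); rewrite mulrVK //.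
  by transitivity (conj a * a * qemb d z * a); [ring | rewrite NE mul1r].
rewrite rmorphM /= qconj_emb; apply: (mulIr UD); rewrite mulrVK //.
by transitivity (conj a * a * qemb d z * (qemb d z * a)); [ring | rewrite NE mul1r].
Qed.

Lemma GL2_form_GU : GL2_form p l (qemb d : {rmorphism R -> S}) (qtheta d) d (GUgroup conj).
Proof.
have V w j : w \is a GRing.unit -> p ^+ j * (w - 1) = 0 -> p ^+ j * (w^-1 - 1) = 0.
  move=> Uw E; apply: (mulrI Uw); rewrite mulr0.
  transitivity (- (p ^+ j * (w - 1))); last by rewrite E oppr0.
  by rewrite mulrCA mulrBr mulrV // mulr1 -mulrN opprB.
split.
- by move=> a b [].
- move=> i [x1 x2] il; rewrite -rmorphXn qembM => -[/= /(chain_ann cR il)[y1 ->] /(chain_ann cR il)[y2 ->]].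
  by exists ((y1, y2) : S); rewrite -rmorphXn qembM.
- exact: qtheta_sqr.
- exact: Ud.
- move=> s; have [|g [ha hb hc hd]] := @GL2_exists S 1 (qemb d s * qtheta d) 0 1.
    by rewrite mulr1 mulr0 subr0 unitr1.
  exists g => //; apply/GUP; rewrite /gD ha hb hc hd !rmorph1 rmorph0 rmorphM /=.
  rewrite qconj_emb qconj_theta mulr1 mulr0 subr0 !divr1 oppr0; split=> //.
  by rewrite mulrN.
(* For j = l any element of norm z^-1 serves. For j < l the upper left entry must be close to 1, and
   the inverse of the square root of z near 1 has norm z^-1. *)
- move=> j z jl Uz Ez; move: jl; rewrite leq_eqVlt => /orP[/eqP jl|jl].
    have Uz' : z^-1 \is a GRing.unit by rewrite unitrV.
    have [x [y xy]] := chain_norm_surj cR l0 Ud Uz'.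
    have [|g Gg [ha hb hc hd]] := @GU_diag (x, y) z Uz; first by rewrite qnormE /= xy.
    exists g => //; rewrite hb hc hd ha; split=> //.
    by rewrite jl -rmorphXn (chain_nil cR) rmorph0 mul0r.
  have [w w1 wE] := chain_sqrt cR jl Ez.
  have Uw : w \is a GRing.unit by apply: (chain_unit_ann cR jl).
  have [|g Gg [ha hb hc hd]] := @GU_diag (qemb d w^-1) z Uz.
    by rewrite qconj_emb -rmorphM -wE expr2 invrM.
  exists g => //; rewrite hb hc hd ha; split=> //.
  by rewrite -rmorphXn -(rmorph1 (qemb d)) -rmorphB -rmorphM V // rmorph0.
- move=> g /GUP[ca cb cc cd]; have UD := gD_unit g.
  (* By unitarity, conj ([ga g]) is [ga g / gD g], so these are the two required quotients; m is
     anti-invariant and n invariant under [conj]. *)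
  pose m := conj (ga g) * gb g; pose n := conj (ga g) * ga g.
  have mE : conj m = - m.
    by rewrite /m rmorphM /= qconjK ca cb; ring.
  have nE : conj n = n by rewrite /n rmorphM /= qconjK mulrC.
  exists m.2, n.1; rewrite -(qconj_anti mE) /= -(qconj_fix nE) /m /n ca.
  by split; rewrite mulrA [gD g * _]mulrC mulrVK.
- move=> g /GUP[ca cb cc cd] Ua; have UD := gD_unit g.
  have Uc : conj (ga g) \is a GRing.unit by rewrite rmorph_unit.
  have cV x : conj (x / ga g) = conj x / conj (ga g) by rewrite rmorphM /= rmorphV.
  have eb : conj (gb g / ga g) = - (gb g / ga g).
    rewrite cV; apply: (mulIr Uc); rewrite mulrVK // ca cb.
    by transitivity (- gb g * ((ga g)^-1 * ga g) / gD g); [rewrite mulVr ?mulr1 | ring].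
  have ec : conj (gc g / ga g) = - (gc g / ga g).
    rewrite cV; apply: (mulIr Uc); rewrite mulrVK // ca cc.
    by transitivity (- gc g * ((ga g)^-1 * ga g) / gD g); [rewrite mulVr ?mulr1 | ring].
  have ed : conj (gd g / ga g) = gd g / ga g.
    rewrite cV; apply: (mulIr Uc); rewrite mulrVK // ca cd.
    by transitivity (gd g * ((ga g)^-1 * ga g) / gD g); [rewrite mulVr ?mulr1 | ring].
  exists ((gb g / ga g).2, (gc g / ga g).2, (gd g / ga g).1) => /=.
  rewrite -(qconj_anti eb) -(qconj_anti ec) /= -(qconj_fix ed).
  by rewrite ![ga g * _]mulrC !mulrVK.
- move=> j g h z jl Gg Gh Uz [ea eb ec ed].
  have Pc : conj (qemb d p ^+ j) = qemb d p ^+ j by rewrite -rmorphXn qconj_emb.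
  set Q := qemb d p ^+ j in Pc ea eb ec ed *.
  have row k : k \in GUgroup conj -> conj (gd k) * ga k + conj (gb k) * gc k = 1.
    by move=> /GUP[_ cb _ cd]; rewrite cb cd -(divrr (gD_unit k)) /gD; ring.
  have cong x y : Q * (x - z * y) = 0 -> Q * conj x = Q * (conj z * conj y).
    move=> /(congr1 conj); rewrite rmorphM rmorph0 /= Pc rmorphB rmorphM /= mulrBr => /eqP.
    by rewrite subr_eq0 => /eqP.
  have cong' x y : Q * (x - z * y) = 0 -> Q * x = Q * (z * y).
    by rewrite mulrBr => /eqP; rewrite subr_eq0 => /eqP.
  set n := (z.1 ^+ 2 - d * z.2 ^+ 2).
  (* Unitarity of g and of h, which is z g modulo p^(l - j), forces the norm of z to be 1 to that
     precision. *)
  have En : Q * (conj z * z - 1) = 0.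
    rewrite mulrBr mulr1; apply/eqP; rewrite subr_eq0 eq_sym; apply/eqP.
    transitivity (Q * conj (gd h) * ga h + Q * conj (gb h) * gc h).
      by rewrite -!mulrA -mulrDr row // mulr1.
    rewrite (cong _ _ ed) (cong _ _ eb).
    transitivity (conj z * conj (gd g) * (Q * ga h) + conj z * conj (gb g) * (Q * gc h)).
      by ring.
    rewrite (cong' _ _ ea) (cong' _ _ ec).
    transitivity (Q * (conj z * z) * (conj (gd g) * ga g + conj (gb g) * gc g)).
      by ring.
    by rewrite row // mulr1.
  have {}En : p ^+ j * (n - 1) = 0.
    move: En; rewrite qnormE -/n /Q -rmorphXn -(rmorph1 (qemb d)) -rmorphB -rmorphM.
    by move=> /(congr1 fst).
  (* Dividing z by a square root of its norm that is close to 1 yields norm exactly 1 without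
     changing the congruence class. *)
  have [s s1 sE] := chain_sqrt cR jl En.
  have Us : s \is a GRing.unit by apply: (chain_unit_ann cR jl).
  have [|k Gk [ka kb kc kd]] := @GU_diag (z * qemb d s^-1) 1 (unitr1 _).
    rewrite rmorphM /= qconj_emb mulrACA qnormE -/n -!rmorphM -sE.
    by rewrite expr2 invr1 -invrM // mulrV // unitrM Us.
  exists k => //; rewrite kb kc kd ka rmorph1 mul1r; split=> //.
  transitivity (z * (Q * (qemb d s^-1 - 1))); first by ring.
  by rewrite /Q -rmorphXn -(rmorph1 (qemb d)) -rmorphB -rmorphM V // rmorph0 mulr0.
Qed.
End Unitary.

Theorem theorem9p2
  (O : idomainType) (pi : O) (q : nat) (l : nat)
  (R : finComUnitRingType) (f : {rmorphism O -> R}) :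
  complete_dvr pi -> residue_card pi q -> odd q ->
  is_quotient_pow pi l f -> (2 <= l)%N ->
  (* G = GL_2 *)
  (forall psi : R -> algC,
     add_char_nontriv psi (f pi ^+ l.-1) ->
     thm92_concl 'GL_2[R]%G (f pi) l 1 psi q) /\
  (* G = GU_2, O_l = o_l[theta], theta^2 = t a non-square unit of O *)
  (forall (t : O), t \is a GRing.unit -> (forall y : O, y * y != t) ->
   forall psi' : R -> algC,
     add_char_nontriv psi' (f pi ^+ l.-1) ->
     thm92_concl (GUgroup (@qconj _ (f t)))
       (qemb (f t) (f pi)) l (qtheta (f t))
       (fun x : quad (f t) => psi' x.1 * psi' x.2) q).
Proof.
move=> dvrO resO oddq quoO l2; have cR := quotient_chain_ring dvrO resO oddq quoO.
have l0 : (0 < l)%N by apply: ltnW.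
split=> [psi [psi0 psiD psi1]|t Ut _ psi [psi0 psiD [x psi1]]].
  exact: GL2_form_tensor cR l2 (GL2_form_GL cR) psi0 psiD psi1.
have formGU := GL2_form_GU (chain_2unit cR) cR l0 (rmorph_unit f Ut).
apply: (GL2_form_tensor cR l2 formGU); first by rewrite /= psi0 mulr1.
  by move=> y z; rewrite /= !psiD mulrACA.
by exists x; rewrite /= psi0 mulr1.
Qed.
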